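(* Let $m\in\mathbb{N}$, $m\ge 1$. On $\Sigma=\mathbb{C}\setminus\{0\}$ consider the Weierstrass data $$g(z)=z,\qquad \omega=i^{\,m-1}z^{-m-3}\left(z^{2m+2}-1\right)dz .$$ Then $X=\mathrm{Re}\int\left(\tfrac12(1-g^2)\omega,\ \tfrac{i}{2}(1+g^2)\omega,\ g\,\omega\right)$ is a well-defined finitely branched minimal immersion $X\colon\Sigma\to\mathbb{R}^3$ which satisfies $X\circ I=X$ for $I(z)=-1/\overline z$, and the induced map $\widehat X\colon \Sigma/\langle I\rangle\to\mathbb{R}^3$ is a 1-sided, complete, stable, finitely branched minimal surface $H_m$.
   Context: A branched minimal immersion is a conformal harmonic map $X\colon\Sigma\to\mathbb{R}^3$ from a Riemann surface which is an immersion outside a locally finite set of points (the branch points). It is finitely branched if this set is finite. The induced (possibly degenerate) metric is $ds^2=\frac14(1+|g|^2)^2|\omega|^2$. Complete means that every divergent curve in the surface has infinite $ds^2$-length. 1-sided: $I(z)=-1/\overline z$ is an anti-holomorphic involution of $\Sigma=\mathbb{C}\setminus\{0\}$ without fixed points, and $\Sigma/\langle I\rangle$ is a non-orientable surface. The map $X$ produces a 1-sided branched minimal surface if it factors through $\Sigma/\langle I\rangle$, i.e. $\widehat X\circ\pi=X$ where $\pi\colon\Sigma\to\Sigma/\langle I\rangle$ is the projection. Stability of $\widehat X$: let $|A|^2$ be the squared norm of the second fundamental form of $X$ and $L=\Delta+|A|^2$ its Jacobi operator. The index of $\widehat X$ is the number of negative eigenvalues of $L$ (defined variationally, the branch set having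 codimension two) acting on compactly supported smooth functions $\phi\colon\Sigma\to\mathbb{R}$ with $\phi\circ I=-\phi$. $\widehat X$ is stable if its index is zero, i.e. if $\int_\Sigma\left(|\nabla\phi|^2-|A|^2\phi^2\right)dA\ge 0$ for all such $\phi$ (this quadratic form is conformally invariant, and $|A|^2dA=|\nabla N|^2dA$ extends smoothly across branch points, $N$ being the Gauss map, i.e. $g$ composed with inverse stereographic projection). *)

(* Defs.v *)
(* Stdlib real numbers with Coquelicot; C = R * R. *)
From Stdlib Require Import Reals List.
From Coquelicot Require Import Coquelicot.
Open Scope R_scope.

(* Maps on a domain D of the plane are total functions on C constrained only on D;
   every domain D below is meant to be open. *)

Definition R3 : Type := (R * R * R)%type.
Definition pr1 (v : R3) : R := fst (fst v).
Definition pr2 (v : R3) : R := snd (fst v).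
Definition pr3 (v : R3) : R := snd v.
Definition dot (u v : R3) : R := pr1 u * pr1 v + pr2 u * pr2 v + pr3 u * pr3 v.
Definition cross (u v : R3) : R3 :=
  (pr2 u * pr3 v - pr3 u * pr2 v,
   pr3 u * pr1 v - pr1 u * pr3 v,
   pr1 u * pr2 v - pr2 u * pr1 v).
Definition scale3 (a : R) (v : R3) : R3 := (a * pr1 v, a * pr2 v, a * pr3 v).
Definition add3 (u v : R3) : R3 := (pr1 u + pr1 v, pr2 u + pr2 v, pr3 u + pr3 v).

(** ** Differential calculus in the plane *)

Definition dx (h : C -> R) (z : C) : R := Derive (fun x => h (x, snd z)) (fst z).
Definition dy (h : C -> R) (z : C) : R := Derive (fun y => h (fst z, y)) (snd z).

(* When it holds at every point of an open set, this says that h is of class C^n there. *)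
Definition Cn_at (n : nat) (h : C -> R) (z : C) : Prop :=
  ex_diff_n (fun x y => h (x, y)) n (fst z) (snd z).

Definition map3 (T : (C -> R) -> C -> R) (X : C -> R3) (z : C) : R3 :=
  (T (fun w => pr1 (X w)) z, T (fun w => pr2 (X w)) z, T (fun w => pr3 (X w)) z).
Definition Dx : (C -> R3) -> C -> R3 := map3 dx.
Definition Dy : (C -> R3) -> C -> R3 := map3 dy.

Definition coordinatewise (P : (C -> R) -> Prop) (X : C -> R3) : Prop :=
  P (fun w => pr1 (X w)) /\ P (fun w => pr2 (X w)) /\ P (fun w => pr3 (X w)).

(** ** Branched minimal immersions *)

Definition harmonic_on (D : C -> Prop) (h : C -> R) : Prop :=
  forall z, D z -> Cn_at 2 h z /\ dx (dx h) z + dy (dy h) z = 0.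

(* Weak conformality: the differential may vanish. *)
Definition conformal_on (D : C -> Prop) (X : C -> R3) : Prop :=
  forall z, D z ->
    dot (Dx X z) (Dx X z) = dot (Dy X z) (Dy X z) /\ dot (Dx X z) (Dy X z) = 0.

Definition immersive_at (X : C -> R3) (z : C) : Prop :=
  forall a b : R,
    add3 (scale3 a (Dx X z)) (scale3 b (Dy X z)) = (0, 0, 0) -> a = 0 /\ b = 0.

Definition branch_point (D : C -> Prop) (X : C -> R3) (z : C) : Prop :=
  D z /\ ~ immersive_at X z.

Definition finite_set {T : Type} (B : T -> Prop) : Prop :=
  exists l : list T, forall x, B x -> In x l.

Definition locally_finite_in (D B : C -> Prop) : Prop :=
  forall z, D z ->
    exists eps : posreal,
      finite_set (fun w => ball (M := C_UniformSpace) z eps w /\ B w).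

Definition branched_minimal_immersion (D : C -> Prop) (X : C -> R3) : Prop :=
  coordinatewise (harmonic_on D) X /\
  conformal_on D X /\
  locally_finite_in D (branch_point D X).

Definition finitely_branched_minimal_immersion (D : C -> Prop) (X : C -> R3) : Prop :=
  branched_minimal_immersion D X /\ finite_set (branch_point D X).

(** ** Weierstrass representation *)

Definition velocity (c : R -> C) (t : R) : C :=
  (Derive (fun s => fst (c s)) t, Derive (fun s => snd (c s)) t).

(* A C^1 arc on [a, b] extends to a C^1 curve on R, by its tangent lines at a and b, so
   nothing is lost in asking for a C^1 curve c on R whose restriction to [a, b] lies in D. *)
Definition C1_curve (c : R -> C) : Prop :=
  forall t,
    ex_derive (fun s => fst (c s)) t /\ ex_derive (fun s => snd (c s)) t /\
    continuous (fun s => fst (velocity c s)) t /\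
    continuous (fun s => snd (velocity c s)) t.

(* The forms phi_k dz of the data (g, omega = f dz). *)
Definition weierstrass_forms (g f : C -> C) : (C -> C) * (C -> C) * (C -> C) :=
  (fun z => (/ 2 * (1 - g z ^ 2) * f z)%C,
   fun z => (Ci / 2 * (1 + g z ^ 2) * f z)%C,
   fun z => (g z * f z)%C).

Definition is_Re_line_integral (phi : C -> C) (c : R -> C) (a b v : R) : Prop :=
  is_RInt (fun t => fst (phi (c t) * velocity c t)%C) a b v.

(* X = Re int (phi_1, phi_2, phi_3) dz on D, up to a translation: the integral along any arc
   is the difference of the values of X at its end points.  Existence of such an X is the
   well-definedness (path independence) of the integral; integrals along piecewise C^1 paths
   are sums of integrals along arcs. *)
Definition is_Re_integral (D : C -> Prop) (Phi : (C -> C) * (C -> C) * (C -> C))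
    (X : C -> R3) : Prop :=
  let '(phi1, phi2, phi3) := Phi in
  forall (c : R -> C) (a b : R),
    a <= b -> C1_curve c -> (forall t, a <= t <= b -> D (c t)) ->
    is_Re_line_integral phi1 c a b (pr1 (X (c b)) - pr1 (X (c a))) /\
    is_Re_line_integral phi2 c a b (pr2 (X (c b)) - pr2 (X (c a))) /\
    is_Re_line_integral phi3 c a b (pr3 (X (c b)) - pr3 (X (c a))).

(** ** First and second fundamental forms of X *)

Definition EE (X : C -> R3) (z : C) : R := dot (Dx X z) (Dx X z).
Definition FF (X : C -> R3) (z : C) : R := dot (Dx X z) (Dy X z).
Definition GG (X : C -> R3) (z : C) : R := dot (Dy X z) (Dy X z).
Definition metric_det (X : C -> R3) (z : C) : R := EE X z * GG X z - FF X z ^ 2.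

(* ds-length of the tangent vector v at z. *)
Definition ds (X : C -> R3) (z v : C) : R :=
  sqrt (EE X z * fst v ^ 2 + 2 * FF X z * fst v * snd v + GG X z * snd v ^ 2).

Definition unit_normal (X : C -> R3) (z : C) : R3 :=
  scale3 (/ sqrt (metric_det X z)) (cross (Dx X z) (Dy X z)).

Definition h11 (X : C -> R3) (z : C) : R := dot (Dx (Dx X) z) (unit_normal X z).
Definition h12 (X : C -> R3) (z : C) : R := dot (Dx (Dy X) z) (unit_normal X z).
Definition h22 (X : C -> R3) (z : C) : R := dot (Dy (Dy X) z) (unit_normal X z).

(* |A|^2 = trace (S^2), where S = I^{-1} II is the shape operator. *)
Definition normA2 (X : C -> R3) (z : C) : R :=
  let s11 := (GG X z * h11 X z - FF X z * h12 X z) / metric_det X z in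
  let s12 := (GG X z * h12 X z - FF X z * h22 X z) / metric_det X z in
  let s21 := (EE X z * h12 X z - FF X z * h11 X z) / metric_det X z in
  let s22 := (EE X z * h22 X z - FF X z * h12 X z) / metric_det X z in
  s11 ^ 2 + 2 * s12 * s21 + s22 ^ 2.

Definition norm_grad2 (X : C -> R3) (phi : C -> R) (z : C) : R :=
  (GG X z * dx phi z ^ 2 - 2 * FF X z * dx phi z * dy phi z + EE X z * dy phi z ^ 2)
  / metric_det X z.

(* Density of (|grad phi|^2 - |A|^2 phi^2) dA with respect to dx dy.  At a branch point
   metric_det is 0 and the total division makes it 0 instead of its smooth extension; this
   changes no integral when the branch points are isolated. *)
Definition jacobi_density (X : C -> R3) (phi : C -> R) (z : C) : R :=
  (norm_grad2 X phi z - normA2 X z * phi z ^ 2) * sqrt (metric_det X z).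

(* Integral over the plane of a function vanishing outside a square. *)
Definition is_plane_integral (h : C -> R) (v : R) : Prop :=
  exists M : R,
    0 < M /\
    (forall x y, M < Rabs x \/ M < Rabs y -> h (x, y) = 0) /\
    (forall y, ex_RInt (fun x => h (x, y)) (- M) M) /\
    is_RInt (fun y => RInt (fun x => h (x, y)) (- M) M) (- M) M v.

(** ** Quotient of a domain by an involution *)

Definition compact_for {T : Type} (is_open : (T -> Prop) -> Prop) (K : T -> Prop) : Prop :=
  forall cover : (T -> Prop) -> Prop,
    (forall U, cover U -> is_open U) ->
    (forall x, K x -> exists U, cover U /\ U x) ->
    exists l : list (T -> Prop),
      (forall U, In U l -> cover U) /\ (forall x, K x -> exists U, In U l /\ U x).

Definition orbit (iota : C -> C) (z : C) : C -> Prop := fun w => w = z \/ w = iota z.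

Definition quot (D : C -> Prop) (iota : C -> C) : Type :=
  { q : C -> Prop | exists z, D z /\ q = orbit iota z }.

Definition proj (D : C -> Prop) (iota : C -> C) (z : C) (Hz : D z) : quot D iota :=
  exist _ (orbit iota z) (ex_intro _ z (conj Hz eq_refl)).

Definition quot_open (D : C -> Prop) (iota : C -> C) (U : quot D iota -> Prop) : Prop :=
  open (T := C_UniformSpace) (fun z => exists Hz : D z, U (proj D iota z Hz)).

(* iota is an anti-holomorphic involution of D without fixed points. *)
Definition free_antiholomorphic_involution (D : C -> Prop) (iota : C -> C) : Prop :=
  forall z, D z ->
    D (iota z) /\ iota (iota z) = z /\ iota z <> z /\
    ex_derive (K := C_AbsRing) (V := C_NormedModule) (fun w => Cconj (iota w)) z.

Definition jacobian (h : C -> C) (z : C) : R :=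
  dx (fun w => fst (h w)) z * dy (fun w => snd (h w)) z
  - dy (fun w => fst (h w)) z * dx (fun w => snd (h w)) z.

(* An orientation of D / iota is given on the lifts of the tangent planes: o z = 1 (resp. -1)
   if the orientation at the class of z lifts to the standard (resp. opposite) one at z.  It is
   locally constant, and the lifts at z and iota z correspond under the differential of iota. *)
Definition quot_orientable (D : C -> Prop) (iota : C -> C) : Prop :=
  exists o : C -> R,
    (forall z, D z -> o z = 1 \/ o z = -1) /\
    (forall z, D z -> locally (T := C_UniformSpace) z (fun w => D w -> o w = o z)) /\
    (forall z, D z -> 0 < o z * o (iota z) * jacobian iota z).

(* X = Xhat o proj on D.  As D is open, the local geometry of X on D depends only on Xhat,
   and it is the geometry of Xhat in the local coordinates provided by proj. *)
Definition is_lift (D : C -> Prop) (iota : C -> C) (Xhat : quot D iota -> R3)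
    (X : C -> R3) : Prop :=
  forall (z : C) (Hz : D z), Xhat (proj D iota z Hz) = X z.

Definition one_sided (D : C -> Prop) (iota : C -> C) (Xhat : quot D iota -> R3)
    (X : C -> R3) : Prop :=
  free_antiholomorphic_involution D iota /\
  ~ quot_orientable D iota /\
  is_lift D iota Xhat X.

Definition quot_finitely_branched_minimal (D : C -> Prop) (iota : C -> C)
    (Xhat : quot D iota -> R3) : Prop :=
  exists X, is_lift D iota Xhat X /\
    branched_minimal_immersion D X /\
    finite_set (fun q => exists (z : C) (Hz : D z),
                           branch_point D X z /\ q = proj D iota z Hz).

(** ** Completeness *)

(* A piecewise C^1 curve q on [0, oo): q is the projection of the C^1 arc c n of D on
   [tau n, tau (n+1)].  The lifts c n and c (n+1) need only agree up to iota at tau (n+1). *)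
Definition piecewise_C1 (D : C -> Prop) (iota : C -> C) (q : R -> quot D iota)
    (tau : nat -> R) (c : nat -> R -> C) : Prop :=
  tau 0%nat = 0 /\
  (forall n, tau n < tau (S n)) /\
  is_lim_seq tau p_infty /\
  forall n, C1_curve (c n) /\
    forall t, tau n <= t <= tau (S n) ->
      exists Hz : D (c n t), q t = proj D iota (c n t) Hz.

Definition divergent (D : C -> Prop) (iota : C -> C) (q : R -> quot D iota) : Prop :=
  forall K : quot D iota -> Prop, compact_for (quot_open D iota) K ->
    exists T, forall t, T <= t -> ~ K (q t).

Definition quot_complete (D : C -> Prop) (iota : C -> C) (Xhat : quot D iota -> R3) : Prop :=
  exists X, is_lift D iota Xhat X /\
    forall (q : R -> quot D iota) (tau : nat -> R) (c : nat -> R -> C),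
      piecewise_C1 D iota q tau c -> divergent D iota q ->
      is_lim_seq
        (sum_n (fun k => RInt (fun t => ds X (c k t) (velocity (c k) t))
                              (tau k) (tau (S k))))
        p_infty.

(** ** Stability *)

(* phi is smooth with compact support in D, extended by 0 outside D. *)
Definition test_function (D : C -> Prop) (phi : C -> R) : Prop :=
  (forall z n, D z -> Cn_at n phi z) /\
  exists K : C -> Prop,
    compact_for (open (T := C_UniformSpace)) K /\
    (forall z, K z -> D z) /\
    (forall z, ~ K z -> phi z = 0).

Definition quot_stable (D : C -> Prop) (iota : C -> C) (Xhat : quot D iota -> R3) : Prop :=
  exists X, is_lift D iota Xhat X /\
    forall phi : C -> R,
      test_function D phi ->
      (forall z, D z -> phi (iota z) = - phi z) ->
      exists v, is_plane_integral (jacobi_density X phi) v /\ 0 <= v.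

(** ** The data *)

Definition punctured_plane (z : C) : Prop := z <> 0%C.

Definition antipodal (z : C) : C := (- (1 / Cconj z))%C.

Definition g_data (z : C) : C := z.

(* omega = f_data m z dz *)
Definition f_data (m : nat) (z : C) : C :=
  (Ci ^ (m - 1) * / z ^ (m + 3) * (z ^ (2 * m + 2) - 1))%C.

(* Main.v *)
Require Import Defs.
From Stdlib Require Import Reals List Lra Lia Psatz ClassicalEpsilon.
From Coquelicot Require Import Coquelicot.
(* Reals has its own Dx, which shadows the one of Defs. *)
Require Import Defs.
Open Scope R_scope.

(** The forms phi_k dz are Laurent polynomials without 1/z term, so X is the real part of an
    explicit Laurent polynomial, and X o I = X follows from the parities of the exponents.
    Since g(z) = z, the Gauss map is inverse stereographic projection, so the stability form
    of X is that of the round sphere: the integral of |grad phi|^2 - 8 phi^2 / (1 + |z|^2)^2.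
    The three coordinates u of the sphere solve Laplace u = - 8 u / (1 + |z|^2)^2, hence the
    form is nonnegative on every phi vanishing where one of them does.  Splitting phi into even
    and odd parts in x and in y splits the form; a part that is odd in x or y vanishes on a
    coordinate plane, and the part even in both vanishes on the unit circle because phi is odd
    under the antipodal map.
    Completeness holds because ds >= |d(|z|^2 + |z|^-2)| / 4, and |z|^2 + |z|^-2 is a proper
    function on the quotient. *)

(** * Integrals of continuous functions over a square *)

(** Barta's argument divides by a solution u without zeros in the domain. Here u is a coordinate
    function of the sphere, so it changes sign along a curve, and cutting the domain along that
    curve would need integration over curved regions. Instead 1/u is replaced by a bounded function,
    discontinuous only at u = 0, where the factor phi^2 hides the jump. Every integration by parts
    then takes place on one square, at the price of an error that is made arbitrarily small. The
    function f of the Weierstrass data cancels from the stability form. Branch points therefore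
    matter only as finitely many points where [jacobi_density] takes a default value instead of its
    smooth extension. The hypothesis on X only fixes it up to a translation, so the local geometry
    is derived for functions that are real parts of holomorphic functions up to a constant. *)

Definition cont2 (f : R -> R -> R) : Prop := forall x y, continuity_2d_pt f x y.

Lemma cont2_plus f g : cont2 f -> cont2 g -> cont2 (fun x y => f x y + g x y).
Proof. intros Hf Hg x y; now apply continuity_2d_pt_plus. Qed.

Lemma cont2_minus f g : cont2 f -> cont2 g -> cont2 (fun x y => f x y - g x y).
Proof. intros Hf Hg x y; now apply continuity_2d_pt_minus. Qed.

Lemma cont2_mult f g : cont2 f -> cont2 g -> cont2 (fun x y => f x y * g x y).
Proof. intros Hf Hg x y; now apply continuity_2d_pt_mult. Qed.

Lemma cont2_const c : cont2 (fun _ _ => c).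
Proof. intros x y; apply continuity_2d_pt_const. Qed.

Lemma cont2_fst : cont2 (fun x _ => x).
Proof. intros x y; apply continuity_2d_pt_id1. Qed.

Lemma cont2_snd : cont2 (fun _ y => y).
Proof. intros x y; apply continuity_2d_pt_id2. Qed.

Lemma cont2_sqr f : cont2 f -> cont2 (fun x y => f x y ^ 2).
Proof.
  intros Hf x y; apply continuity_2d_pt_ext with (fun x y => f x y * f x y).
  - intros; ring.
  - now apply continuity_2d_pt_mult.
Qed.

Lemma cont2_inv f : cont2 f -> (forall x y, f x y <> 0) -> cont2 (fun x y => / f x y).
Proof. intros Hf Hn x y; now apply continuity_2d_pt_inv. Qed.

Lemma cont2_swap f : cont2 f -> cont2 (fun x y => f y x).
Proof.
  intros Hf x y eps; destruct (Hf y x eps) as [d Hd].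
  exists d; intros u v Hu Hv; now apply Hd.
Qed.

Lemma cont2_reflect_x f : cont2 f -> cont2 (fun x y => f (- x) y).
Proof.
  intros Hf x y eps; destruct (Hf (- x) y eps) as [d Hd].
  exists d; intros u v Hu Hv; apply Hd; trivial.
  now replace (- u - - x) with (- (u - x)) by ring; rewrite Rabs_Ropp.
Qed.

Lemma cont2_reflect_y f : cont2 f -> cont2 (fun x y => f x (- y)).
Proof.
  intros Hf; apply (cont2_swap (fun y x => f x (- y))).
  exact (cont2_reflect_x (fun y x => f x y) (cont2_swap f Hf)).
Qed.

Lemma cont2_slice f y x : cont2 f -> continuous (fun t => f t y) x.
Proof.
  intros Hf; apply continuity_pt_filterlim.
  intros eps Heps; destruct (Hf x y (mkposreal eps Heps)) as [d Hd].
  exists d; split; [apply cond_pos|].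
  intros t [_ Ht]; simpl in *; unfold R_dist in *; apply Hd; trivial.
  rewrite Rminus_diag, Rabs_R0; apply cond_pos.
Qed.

Lemma cont2_ex_RInt f y a b : cont2 f -> ex_RInt (fun x => f x y) a b.
Proof. intros Hf; apply (ex_RInt_continuous (V := R_CompleteNormedModule)); intros x _; now apply cont2_slice. Qed.

(** By uniform continuity along the compact segment, the slices at t and y differ little, uniformly
    in x. *)
Lemma continuous_RInt_slice f a b y :
  a < b -> cont2 f -> continuous (fun t => RInt (fun x => f x t) a b) y.
Proof.
  intros Hab Hf; apply continuity_pt_filterlim.
  intros eps Heps.
  (* The extra 2 leaves eps / 2 after integration, since [abs_RInt_le_const] gives only a weak
     inequality. *)
  assert (He : 0 < eps / (2 * (b - a))) by (apply Rdiv_lt_0_compat; lra).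
  destruct (uniform_continuity_2d_1d f a b y (fun x _ => Hf x y) (mkposreal _ He)) as [d Hd].
  exists d; split; [apply cond_pos|].
  intros t [_ Ht]; simpl in *; unfold R_dist in *.
  pose proof (cond_pos d) as Hdp.
  apply Rabs_def2 in Ht.
  assert (Hm : Rabs (RInt (fun x => f x t - f x y) a b)
                <= (b - a) * (eps / (2 * (b - a)))).
  { apply abs_RInt_le_const; [lra| |].
    - apply (cont2_ex_RInt (fun x y' => f x t - f x y) y).
      intros u v; apply continuity_2d_pt_minus.
      + intros e; destruct (Hf u t e) as [d' Hd']; exists d'; intros u' v' H1 H2.
        apply Hd'; trivial; rewrite Rminus_diag, Rabs_R0; apply cond_pos.
      + intros e; destruct (Hf u y e) as [d' Hd']; exists d'; intros u' v' H1 H2.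
        apply Hd'; trivial; rewrite Rminus_diag, Rabs_R0; apply cond_pos.
    - intros x Hx; apply Rlt_le, Hd; try lra; rewrite Rminus_diag, Rabs_R0; apply cond_pos. }
  replace ((b - a) * (eps / (2 * (b - a)))) with (eps / 2) in Hm by (field; lra).
  pose proof (RInt_minus (V := R_CompleteNormedModule) (fun x => f x t) (fun x => f x y) a b
    (cont2_ex_RInt f t a b Hf) (cont2_ex_RInt f y a b Hf)) as He2.
  unfold minus, plus, opp in He2; simpl in He2; unfold Rminus in Hm; rewrite He2 in Hm.
  unfold Rminus.
  apply Rle_lt_trans with (1 := Hm). lra.
Qed.

Definition square_integral (M : R) (f : R -> R -> R) : R :=
  RInt (fun y => RInt (fun x => f x y) (- M) M) (- M) M.

Lemma ex_square_integral M f : 0 < M -> cont2 f ->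
  ex_RInt (fun y => RInt (fun x => f x y) (- M) M) (- M) M.
Proof.
  intros HM Hf; apply (ex_RInt_continuous (V := R_CompleteNormedModule)); intros y _.
  apply continuous_RInt_slice; trivial; lra.
Qed.

Lemma square_integral_ext M f g :
  (forall x y, f x y = g x y) -> square_integral M f = square_integral M g.
Proof. intros H; apply RInt_ext; intros y _; apply RInt_ext; intros x _; apply H. Qed.

Lemma square_integral_plus M f g : 0 < M -> cont2 f -> cont2 g ->
  square_integral M (fun x y => f x y + g x y) = square_integral M f + square_integral M g.
Proof.
  intros HM Hf Hg; unfold square_integral.
  rewrite <- (RInt_plus (V := R_CompleteNormedModule)
    (fun y => RInt (fun x => f x y) (- M) M)) by now apply ex_square_integral.
  apply RInt_ext; intros y _.
  now rewrite <- (RInt_plus (V := R_CompleteNormedModule)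
    (fun x => f x y) (fun x => g x y)) by now apply cont2_ex_RInt.
Qed.

Lemma square_integral_scal M a f : 0 < M -> cont2 f ->
  square_integral M (fun x y => a * f x y) = a * square_integral M f.
Proof.
  intros HM Hf; unfold square_integral.
  rewrite <- (RInt_scal (V := R_CompleteNormedModule)
    (fun y => RInt (fun x => f x y) (- M) M)) by now apply ex_square_integral.
  apply RInt_ext; intros y _.
  now rewrite <- (RInt_scal (V := R_CompleteNormedModule) (fun x => f x y))
    by now apply cont2_ex_RInt.
Qed.

Lemma square_integral_const M c : 0 < M -> square_integral M (fun _ _ => c) = 4 * M ^ 2 * c.
Proof.
  intros HM; unfold square_integral; rewrite !RInt_const; unfold scal; simpl.
  unfold mult; simpl; ring.
Qed.

Lemma square_integral_le M f g : 0 < M -> cont2 f -> cont2 g ->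
  (forall x y, - M < x < M -> - M < y < M -> f x y <= g x y) ->
  square_integral M f <= square_integral M g.
Proof.
  intros HM Hf Hg H; apply RInt_le; [lra|now apply ex_square_integral..|].
  intros y Hy; apply RInt_le; [lra|now apply cont2_ex_RInt..|].
  intros x Hx; now apply H.
Qed.

Lemma square_integral_reflect_x M f : 0 < M -> cont2 f ->
  square_integral M (fun x y => f (- x) y) = square_integral M f.
Proof.
  intros HM Hf; apply RInt_ext; intros y _.
  (* The substitution of slope -1 negates the integrand and reverses the bounds; the inserted [opp]
     on each side make the two signs cancel. *)
  pose proof (RInt_comp_lin (V := R_CompleteNormedModule) (fun x => f x y) (-1) 0 (- M) M) as H.
  rewrite <- (opp_opp (RInt (fun x => f (- x) y) (- M) M)).
  rewrite <- (RInt_opp (V := R_CompleteNormedModule) (fun x => f (- x) y))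
    by now apply (cont2_ex_RInt (fun x y => f (- x) y)), cont2_reflect_x.
  rewrite <- (opp_RInt_swap (V := R_CompleteNormedModule) (fun x => f x y))
    by now apply cont2_ex_RInt.
  f_equal.
  replace (-1 * M + 0) with (- M) in H by ring.
  replace (-1 * - M + 0) with M in H by ring.
  rewrite <- H by now apply cont2_ex_RInt.
  apply RInt_ext; intros x _; unfold scal, opp; simpl; unfold mult; simpl.
  replace (-1 * x + 0) with (- x) by ring; ring.
Qed.

Lemma square_integral_reflect_y M f : 0 < M -> cont2 f ->
  square_integral M (fun x y => f x (- y)) = square_integral M f.
Proof.
  intros HM Hf; unfold square_integral.
  pose proof (ex_square_integral M f HM Hf) as Hex.
  set (h := fun y => RInt (fun x => f x y) (- M) M) in *.
  change (RInt (fun y => h (- y)) (- M) M = RInt h (- M) M).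
  pose proof (RInt_comp_lin (V := R_CompleteNormedModule) h (-1) 0 (- M) M) as H.
  rewrite <- (opp_opp (RInt (fun x => h (- x)) (- M) M)).
  replace (-1 * M + 0) with (- M) in H by ring.
  replace (-1 * - M + 0) with M in H by ring.
  rewrite <- (RInt_opp (V := R_CompleteNormedModule) (fun x => h (- x))).
  - rewrite <- (opp_RInt_swap (V := R_CompleteNormedModule) h) by now apply ex_RInt_swap.
    f_equal; rewrite <- H by now apply ex_RInt_swap.
    apply RInt_ext; intros x _; unfold scal, opp; simpl; unfold mult; simpl.
    replace (-1 * x + 0) with (- x) by ring; ring.
  - apply (ex_square_integral M (fun x y => f x (- y)) HM).
    now apply cont2_reflect_y.
Qed.

Lemma square_integral_dx M (W Wx : R -> R -> R) : 0 < M -> cont2 Wx ->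
  (forall x y, is_derive (fun t => W t y) x (Wx x y)) ->
  (forall y, W (- M) y = 0 /\ W M y = 0) ->
  square_integral M Wx = 0.
Proof.
  intros HM Hc Hd H0; unfold square_integral.
  rewrite (RInt_ext _ (fun _ => 0)).
  - rewrite RInt_const; apply (scal_zero_r (V := R_NormedModule)).
  - intros y _; apply is_RInt_unique.
    replace 0 with (minus (W M y) (W (- M) y)).
    + apply (is_RInt_derive (V := R_CompleteNormedModule) (fun t => W t y)).
      * intros x _; apply Hd.
      * intros x _; now apply cont2_slice.
    + destruct (H0 y) as [-> ->]; unfold minus, plus, opp; simpl; ring.
Qed.

(** With [square_integral_dx] this is the divergence theorem for fields vanishing on the sides. The
    inner variable is x, so the y-derivative must first be pulled out of the inner integral before
    the fundamental theorem applies. *)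
Lemma square_integral_dy M (W Wy : R -> R -> R) : 0 < M -> cont2 Wy ->
  (forall x y, is_derive (fun t => W x t) y (Wy x y)) ->
  (forall x y, continuous (fun t => W t y) x) ->
  (forall x, W x (- M) = 0 /\ W x M = 0) ->
  square_integral M Wy = 0.
Proof.
  intros HM Hc Hd HW H0; unfold square_integral.
  assert (HD : forall x y, Derive (fun t => W x t) y = Wy x y)
    by (intros; apply is_derive_unique, Hd).
  apply is_RInt_unique.
  pose (G := fun y => RInt (fun x => W x y) (- M) M).
  replace 0 with (minus (G M) (G (- M))).
  - apply (is_RInt_derive (V := R_CompleteNormedModule) G).
    + intros y _.
      replace (RInt (fun x => Wy x y) (- M) M)
        with (RInt (fun x => Derive (fun t => W x t) y) (- M) M)
        by (apply RInt_ext; intros; apply HD).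
      apply (is_derive_RInt_param (fun y x => W x y) (- M) M y).
      * apply filter_forall; intros z t _; eexists; apply Hd.
      * intros t _; apply continuity_2d_pt_ext with (fun u v => Wy v u).
        -- intros; symmetry; apply HD.
        -- now apply cont2_swap.
      * apply filter_forall; intros z; apply (ex_RInt_continuous (V := R_CompleteNormedModule)); intros x _; apply HW.
    + intros y _; apply continuous_RInt_slice; trivial; lra.
  - unfold G.
    rewrite (RInt_ext (fun x => W x M) (fun _ => 0)) by (intros; apply H0).
    rewrite (RInt_ext (fun x => W x (- M)) (fun _ => 0)) by (intros; apply H0).
    rewrite RInt_const; unfold minus, plus, opp; simpl; ring.
Qed.

(** * Completing the square with a positive solution *)

(* A bounded substitute for 1/u that still satisfies k' = - k^2 where u <> 0. *)
Definition damped_inv (e u : R) : R :=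
  if Rlt_dec 0 u then / (u + e) else if Rlt_dec u 0 then / (u - e) else 0.

Lemma damped_inv_bound e u : 0 < e -> Rabs (damped_inv e u) <= / e.
Proof.
  intros He; unfold damped_inv; destruct (Rlt_dec 0 u); [|destruct (Rlt_dec u 0)].
  - rewrite Rabs_inv; apply Rinv_le_contravar; trivial.
    rewrite Rabs_right; lra.
  - rewrite Rabs_inv; apply Rinv_le_contravar; trivial.
    rewrite Rabs_left; lra.
  - rewrite Rabs_R0; apply Rlt_le, Rinv_0_lt_compat, He.
Qed.

Lemma damped_inv_mult e u : 0 < e -> u <> 0 -> 1 - u * damped_inv e u = e / (Rabs u + e).
Proof.
  intros He Hu; unfold damped_inv; destruct (Rlt_dec 0 u); [|destruct (Rlt_dec u 0)].
  - rewrite Rabs_right by lra; field; lra.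
  - rewrite Rabs_left by lra; field; lra.
  - lra.
Qed.

Lemma is_derive_damped_inv e u : 0 < e -> u <> 0 ->
  is_derive (damped_inv e) u (- damped_inv e u ^ 2).
Proof.
  intros He Hu; unfold damped_inv at 2; destruct (Rlt_dec 0 u) as [H|H];
    [|destruct (Rlt_dec u 0) as [H1|H1]; [|lra]].
  - apply is_derive_ext_loc with (fun v => / (v + e)).
    + exists (mkposreal u H); intros v Hv; unfold damped_inv.
      apply Rabs_def2 in Hv; unfold minus, plus, opp in Hv; simpl in Hv.
      destruct (Rlt_dec 0 v); lra.
    + auto_derive; [lra|field; lra].
  - assert (H2 : 0 < - u) by lra.
    apply is_derive_ext_loc with (fun v => / (v - e)).
    + exists (mkposreal (- u) H2); intros v Hv; unfold damped_inv.
      apply Rabs_def2 in Hv; unfold minus, plus, opp in Hv; simpl in Hv.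
      destruct (Rlt_dec 0 v), (Rlt_dec v 0); lra.
    + auto_derive; [lra|field; lra].
Qed.

(** Near t the function p is O(h), so f is O(h^2), whatever its regularity. This handles the points
    where [damped_inv] jumps. *)
Lemma is_derive_quadratic_bound (f p : R -> R) t p' K :
  is_derive p t p' -> p t = 0 -> (forall s, Rabs (f s) <= K * p s ^ 2) ->
  is_derive f t 0.
Proof.
  intros Hp Hp0 Hf; apply is_derive_Reals; apply is_derive_Reals in Hp.
  assert (Hf0 : f t = 0).
  { specialize (Hf t); rewrite Hp0 in Hf.
    destruct (Req_dec (f t) 0) as [|Hn]; trivial.
    apply Rabs_pos_lt in Hn; nra. }
  assert (HK : forall h, Rabs (f (t + h)) <= (Rabs K) * p (t + h) ^ 2).
  { intros h; apply Rle_trans with (1 := Hf _).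
    apply Rmult_le_compat_r; [nra|apply Rle_abs]. }
  (* Lipschitz constant of p at t: for small h the difference quotient is within 1 of p'. The + 1 in
     the denominators below guards against K = 0. *)
  set (B := Rabs p' + 1).
  assert (HB : 1 <= B) by (unfold B; pose proof (Rabs_pos p'); lra).
  pose proof (Rabs_pos K) as HKp.
  intros eps Heps.
  assert (Hq : 0 < eps / (Rabs K * B ^ 2 + 1)) by (apply Rdiv_lt_0_compat; nra).
  destruct (Hp 1 Rlt_0_1) as [d Hd].
  assert (Hm : 0 < Rmin d (eps / (Rabs K * B ^ 2 + 1)))
    by (apply Rmin_pos; [apply cond_pos|trivial]).
  exists (mkposreal _ Hm); intros h Hh Hhd; simpl in Hhd.
  assert (H1 : Rabs h < d) by (apply Rlt_le_trans with (1 := Hhd), Rmin_l).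
  assert (H2 : Rabs h < eps / (Rabs K * B ^ 2 + 1))
    by (apply Rlt_le_trans with (1 := Hhd), Rmin_r).
  specialize (Hd h Hh H1).
  assert (Hah : 0 < Rabs h) by now apply Rabs_pos_lt.
  assert (Hph : Rabs (p (t + h)) <= B * Rabs h).
  { rewrite Hp0, Rminus_0_r in Hd.
    replace (p (t + h)) with ((p (t + h) / h - p' + p') * h) by (field; trivial).
    rewrite Rabs_mult; apply Rmult_le_compat_r; [lra|].
    eapply Rle_trans; [apply Rabs_triang|unfold B; lra]. }
  rewrite Hf0, !Rminus_0_r; unfold Rdiv; rewrite Rabs_mult, Rabs_inv.
  apply Rmult_lt_reg_r with (Rabs h); trivial.
  rewrite Rmult_assoc, Rinv_l, Rmult_1_r by lra.
  apply Rle_lt_trans with (1 := HK h).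
  rewrite <- (pow2_abs (p (t + h))).
  apply Rle_lt_trans with (Rabs K * (B * Rabs h) ^ 2).
  - apply Rmult_le_compat_l; trivial; apply pow_incr; split; [apply Rabs_pos|trivial].
  - apply Rmult_lt_compat_r with (r := Rabs K * B ^ 2 + 1) in H2; [|nra].
    replace (eps / (Rabs K * B ^ 2 + 1) * (Rabs K * B ^ 2 + 1)) with eps in H2
      by (field; nra).
    nra.
Qed.

(** Where u is nonzero this is the product rule with k' = - k^2. Where u vanishes so does p, and
    both the derivative and the displayed formula are 0, so one formula covers both cases. *)
Lemma is_derive_damped e (u p : R -> R) t u' p' :
  0 < e -> is_derive u t u' -> is_derive p t p' -> (u t = 0 -> p t = 0) ->
  is_derive (fun s => damped_inv e (u s) * p s ^ 2) t
    (damped_inv e (u t) * (2 * p t * p')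
     - damped_inv e (u t) * (damped_inv e (u t) * (u' * p t ^ 2))).
Proof.
  intros He Hu Hp H0; destruct (Req_dec (u t) 0) as [Hz|Hn].
  - rewrite (H0 Hz); replace (_ - _) with 0 by ring.
    apply is_derive_quadratic_bound with p p' (/ e); auto.
    intros s; rewrite Rabs_mult, (Rabs_right (p s ^ 2)) by nra.
    apply Rmult_le_compat_r; [nra|now apply damped_inv_bound].
  - pose proof (is_derive_comp (damped_inv e) u t _ _ (is_derive_damped_inv e (u t) He Hn) Hu) as H1.
    pose proof (is_derive_mult _ _ t _ _ H1 (is_derive_pow p 2 t p' Hp) Rmult_comm) as H2.
    eapply is_derive_ext; [|eapply (eq_rect _ (is_derive _ t) H2)].
    + intros s; unfold mult; simpl; reflexivity.
    + unfold plus, mult, scal; simpl; unfold mult; simpl; ring.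
Qed.

(** At a zero of u, a function bounded by 1/e multiplies one that tends to 0. *)
Lemma cont2_damped e u g : 0 < e -> cont2 u -> cont2 g ->
  (forall x y, u x y = 0 -> g x y = 0) -> cont2 (fun x y => damped_inv e (u x y) * g x y).
Proof.
  intros He Hu Hg H0 x y; destruct (Req_dec (u x y) 0) as [Hz|Hn].
  - intros eps.
    assert (Hee : 0 < eps * e) by (apply Rmult_lt_0_compat; [apply cond_pos|trivial]).
    destruct (Hg x y (mkposreal _ Hee)) as [d Hd]; exists d; intros a b Ha Hb.
    specialize (Hd a b Ha Hb); simpl in Hd.
    rewrite (H0 x y Hz), Rminus_0_r in Hd; rewrite (H0 x y Hz), Rmult_0_r, Rminus_0_r, Rabs_mult.
    apply Rle_lt_trans with (/ e * Rabs (g a b)).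
    + apply Rmult_le_compat_r; [apply Rabs_pos|now apply damped_inv_bound].
    + apply Rmult_lt_reg_l with e; trivial; rewrite <- Rmult_assoc, Rinv_r by lra; lra.
  - apply continuity_2d_pt_mult; [|apply Hg].
    apply continuity_1d_2d_pt_comp; [|apply Hu].
    apply derivable_continuous_pt; exists (- damped_inv e (u x y) ^ 2).
    apply is_derive_Reals, is_derive_damped_inv; trivial.
Qed.

Create HintDb cont2.
#[export] Hint Resolve cont2_plus cont2_minus cont2_mult cont2_sqr cont2_const cont2_fst cont2_snd : cont2.

(** Compactness of the square makes the local choices uniform. A single d bounds |u| from below
    where phi is not small and phi^2 from above everywhere; [e] is later chosen in terms of it. *)
Lemma small_near_zero_set M (u phi : R -> R -> R) eta :
  cont2 u -> cont2 phi -> (forall x y, u x y = 0 -> phi x y = 0) -> 0 < eta ->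
  exists d, 0 < d /\ forall x y, - M <= x <= M -> - M <= y <= M ->
    (phi x y ^ 2 <= eta \/ d <= Rabs (u x y)) /\ phi x y ^ 2 <= / d.
Proof.
  intros Hu Hphi H0 Heta.
  assert (Hloc : forall x0 y0, exists d : posreal, forall x y,
    Rabs (x - x0) < d -> Rabs (y - y0) < d ->
    (phi x y ^ 2 <= eta \/ d <= Rabs (u x y)) /\ phi x y ^ 2 <= / d).
  { intros x0 y0.
    destruct (cont2_sqr phi Hphi x0 y0 (mkposreal _ Heta)) as [d1 Hd1].
    destruct (cont2_sqr phi Hphi x0 y0 (mkposreal _ Rlt_0_1)) as [d2 Hd2].
    simpl in Hd1, Hd2.
    assert (Hb : 0 < / (phi x0 y0 ^ 2 + 1)) by (apply Rinv_0_lt_compat; nra).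
    destruct (Req_dec (u x0 y0) 0) as [Hz|Hn].
    - rewrite (H0 _ _ Hz) in Hd1, Hd2.
      assert (Hm : 0 < Rmin (Rmin d1 d2) 1)
        by (repeat apply Rmin_pos; try apply cond_pos; lra).
      exists (mkposreal _ Hm); simpl; intros x y Hx Hy.
      assert (Hl1 := Rmin_l (Rmin d1 d2) 1); assert (Hl2 := Rmin_r (Rmin d1 d2) 1).
      assert (Hl3 := Rmin_l d1 d2); assert (Hl4 := Rmin_r d1 d2).
      specialize (Hd1 x y ltac:(lra) ltac:(lra)); specialize (Hd2 x y ltac:(lra) ltac:(lra)).
      apply Rabs_def2 in Hd1; apply Rabs_def2 in Hd2; split; [left; lra|].
      apply Rle_trans with (/ 1); [lra|now apply Rinv_le_contravar].
    - assert (Hh : 0 < Rabs (u x0 y0) / 2) by (apply Rabs_pos_lt in Hn; lra).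
      destruct (Hu x0 y0 (mkposreal _ Hh)) as [d3 Hd3]; simpl in Hd3.
      (* Within d2, phi^2 stays below its central value plus 1; within d3, |u| stays above half its
         central value. The other two entries compare these bounds with d and 1/d. *)
      set (d := Rmin (Rmin d2 d3) (Rmin (Rabs (u x0 y0) / 2) (/ (phi x0 y0 ^ 2 + 1)))).
      assert (Hm : 0 < d) by (unfold d; repeat apply Rmin_pos; try apply cond_pos; trivial).
      assert (Hl1 : d <= Rmin d2 d3) by apply Rmin_l.
      assert (Hl2 : d <= Rmin (Rabs (u x0 y0) / 2) (/ (phi x0 y0 ^ 2 + 1))) by apply Rmin_r.
      assert (Hl3 := Rmin_l d2 d3); assert (Hl4 := Rmin_r d2 d3).
      assert (Hl5 := Rmin_l (Rabs (u x0 y0) / 2) (/ (phi x0 y0 ^ 2 + 1))).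
      assert (Hl6 := Rmin_r (Rabs (u x0 y0) / 2) (/ (phi x0 y0 ^ 2 + 1))).
      exists (mkposreal _ Hm); simpl; intros x y Hx Hy.
      specialize (Hd2 x y ltac:(lra) ltac:(lra)); specialize (Hd3 x y ltac:(lra) ltac:(lra)).
      apply Rabs_def2 in Hd2; split.
      + right; pose proof (Rabs_triang_inv (u x0 y0) (u x y)).
        rewrite Rabs_minus_sym in Hd3; lra.
      + apply Rle_trans with (/ / (phi x0 y0 ^ 2 + 1)); [rewrite Rinv_inv; lra|].
        apply Rinv_le_contravar; lra. }
  pose (delta := fun x0 y0 => proj1_sig (constructive_indefinite_description _ (Hloc x0 y0))).
  assert (Hdelta : forall x0 y0 x y,
    Rabs (x - x0) < delta x0 y0 -> Rabs (y - y0) < delta x0 y0 ->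
    (phi x y ^ 2 <= eta \/ delta x0 y0 <= Rabs (u x y)) /\ phi x y ^ 2 <= / delta x0 y0)
    by (intros x0 y0; exact (proj2_sig (constructive_indefinite_description _ (Hloc x0 y0)))).
  destruct (compactness_value_2d (- M) M (- M) M delta) as [d Hd].
  exists d; split; [apply cond_pos|]; intros x y Hx Hy.
  (* [compactness_value_2d] provides the nearby centre only under a double negation. *)
  apply NNPP; intros Hc; apply (Hd x y Hx Hy); intros (x0 & y0 & _ & _ & H1 & H2 & H3); apply Hc.
  destruct (Hdelta x0 y0 x y H1 H2) as [H4 H5]; split; [destruct H4; [now left|right; lra]|].
  apply Rle_trans with (1 := H5), Rinv_le_contravar; trivial; apply cond_pos.
Qed.

Lemma Rle_of_forall_eps K a : (forall eta, 0 < eta -> - (K * eta) <= a) -> 0 <= a.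
Proof.
  intros H; apply Rnot_lt_le; intros Ha.
  pose proof (Rabs_pos K); pose proof (Rle_abs K).
  assert (He : 0 < - a / (2 * (Rabs K + 1))) by (apply Rdiv_lt_0_compat; lra).
  specialize (H _ He).
  assert (Hm : K * (- a / (2 * (Rabs K + 1))) <= (Rabs K + 1) * (- a / (2 * (Rabs K + 1))))
    by (apply Rmult_le_compat_r; lra).
  replace ((Rabs K + 1) * (- a / (2 * (Rabs K + 1)))) with (- a / 2) in Hm by (field; lra).
  lra.
Qed.

(* Barta's trick.  With p = k(u) grad u, completing the square in grad phi - phi p leaves a
   divergence and the error V (1 - u k(u)) phi^2, which is small because phi vanishes with u. *)
Lemma dirichlet_potential_nonneg M B (V u ux uy uxx uyy phi phix phiy : R -> R -> R) :
  0 < M ->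
  cont2 V -> cont2 u -> cont2 ux -> cont2 uy -> cont2 uxx -> cont2 uyy ->
  (forall x y, is_derive (fun t => u t y) x (ux x y)) ->
  (forall x y, is_derive (fun t => u x t) y (uy x y)) ->
  (forall x y, is_derive (fun t => ux t y) x (uxx x y)) ->
  (forall x y, is_derive (fun t => uy x t) y (uyy x y)) ->
  (forall x y, uxx x y + uyy x y = - V x y * u x y) ->
  (forall x y, 0 <= V x y <= B) ->
  cont2 phi -> cont2 phix -> cont2 phiy ->
  (forall x y, is_derive (fun t => phi t y) x (phix x y)) ->
  (forall x y, is_derive (fun t => phi x t) y (phiy x y)) ->
  (forall x y, M <= Rabs x \/ M <= Rabs y -> phi x y = 0) ->
  (forall x y, u x y = 0 -> phi x y = 0) ->
  0 <= square_integral M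
         (fun x y => phix x y ^ 2 + phiy x y ^ 2 - V x y * phi x y ^ 2).
Proof.
  intros HM cV cu cux cuy cuxx cuyy dux duy duxx duyy Hlap HV cp cpx cpy dpx dpy Hsupp H0.
  (* The area of the square times the bound of V. *)
  apply Rle_of_forall_eps with (4 * M ^ 2 * B); intros eta Heta.
  destruct (small_near_zero_set M u phi eta cu cp H0 Heta) as (d & Hd & Hsmall).
  (* Where |u| >= d this gives 1 - u k = e / (|u| + e) <= eta d, and phi^2 <= 1/d then bounds the
     error by eta. *)
  set (e := eta * d ^ 2).
  assert (He : 0 < e) by (unfold e; apply Rmult_lt_0_compat; nra).
  set (k := fun x y => damped_inv e (u x y)).
  assert (HM0 : forall y, phi (- M) y = 0 /\ phi M y = 0)
    by (intros y; split; apply Hsupp; left; [rewrite Rabs_Ropp|]; apply Rle_abs).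
  assert (HM1 : forall x, phi x (- M) = 0 /\ phi x M = 0)
    by (intros x; split; apply Hsupp; right; [rewrite Rabs_Ropp|]; apply Rle_abs).
  assert (ck : forall g, cont2 g -> (forall x y, u x y = 0 -> g x y = 0) ->
    cont2 (fun x y => k x y * g x y)) by (intros g; now apply cont2_damped).
  assert (z2 : forall x y, u x y = 0 -> phi x y ^ 2 = 0)
    by (intros x y Hz; rewrite (H0 _ _ Hz); ring).
  (* The field W = k phi^2 grad u, with divergence D1 + D2. It vanishes on the sides of the square
     together with phi. *)
  set (W1 := fun x y => ux x y * (k x y * phi x y ^ 2)).
  set (W2 := fun x y => uy x y * (k x y * phi x y ^ 2)).
  set (D1 := fun x y => uxx x y * (k x y * phi x y ^ 2)
    + ux x y * (k x y * (2 * phi x y * phix x y) - k x y * (k x y * (ux x y * phi x y ^ 2)))).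
  set (D2 := fun x y => uyy x y * (k x y * phi x y ^ 2)
    + uy x y * (k x y * (2 * phi x y * phiy x y) - k x y * (k x y * (uy x y * phi x y ^ 2)))).
  assert (c2 : cont2 (fun x y => k x y * phi x y ^ 2)) by (apply ck; auto with cont2).
  assert (cD1 : cont2 D1).
  { unfold D1; apply cont2_plus; apply cont2_mult; trivial.
    apply cont2_minus; repeat apply ck; auto 10 with cont2; intros x y Hz;
      rewrite (H0 _ _ Hz); ring. }
  assert (cD2 : cont2 D2).
  { unfold D2; apply cont2_plus; apply cont2_mult; trivial.
    apply cont2_minus; repeat apply ck; auto 10 with cont2; intros x y Hz;
      rewrite (H0 _ _ Hz); ring. }
  assert (I1 : square_integral M D1 = 0).
  { apply square_integral_dx with W1; trivial.
    - intros x y; unfold W1, D1.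
      apply (is_derive_mult (fun t => ux t y) (fun t => k t y * phi t y ^ 2) x);
        [apply duxx| |apply Rmult_comm].
      apply (is_derive_damped e (fun t => u t y) (fun t => phi t y)); auto.
    - intros y; unfold W1; destruct (HM0 y) as [-> ->]; split; ring. }
  assert (I2 : square_integral M D2 = 0).
  { apply square_integral_dy with W2; trivial.
    - intros x y; unfold W2, D2.
      apply (is_derive_mult (fun t => uy x t) (fun t => k x t * phi x t ^ 2) y);
        [apply duyy| |apply Rmult_comm].
      apply (is_derive_damped e (fun t => u x t) (fun t => phi x t)); auto.
    - intros x y; apply (cont2_slice W2); apply cont2_mult; trivial.
    - intros y; unfold W2; destruct (HM1 y) as [-> ->]; split; ring. }
  assert (cq : cont2 (fun x y => phix x y ^ 2 + phiy x y ^ 2 - V x y * phi x y ^ 2))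
    by auto with cont2.
  apply Rle_trans with (square_integral M (fun x y => (D1 x y + D2 x y) + - (B * eta))).
  - rewrite !square_integral_plus, square_integral_const, I1, I2; auto with cont2; lra.
  - apply square_integral_le; auto with cont2; intros x y Hx Hy.
    (* With the equation for u, |grad phi|^2 - V phi^2 equals |grad phi - k phi grad u|^2 + div W -
       V (1 - u k) phi^2. Only the last term has to be estimated. *)
    assert (Herr : V x y * ((1 - u x y * k x y) * phi x y ^ 2) <= B * eta).
    { assert (Hs : 0 <= (1 - u x y * k x y) * phi x y ^ 2 <= eta).
      { destruct (Req_dec (u x y) 0) as [Hz|Hn]; [rewrite (z2 _ _ Hz), Rmult_0_r; lra|].
        unfold k; rewrite damped_inv_mult by trivial.
        pose proof (Rabs_pos_lt _ Hn) as Hau.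
        assert (Hf : 0 <= e / (Rabs (u x y) + e) <= 1).
        { split; [apply Rlt_le, Rdiv_lt_0_compat; lra|].
          apply Rmult_le_reg_r with (Rabs (u x y) + e); [lra|].
          unfold Rdiv; rewrite Rmult_assoc, Rinv_l by lra; lra. }
        assert (Hp2 : 0 <= phi x y ^ 2) by nra.
        split; [nra|].
        destruct (Hsmall x y ltac:(lra) ltac:(lra)) as [[Hs|Hs] Hs2]; [nra|].
        assert (Hf2 : e / (Rabs (u x y) + e) <= eta * d).
        { apply Rmult_le_reg_r with (Rabs (u x y) + e); [lra|].
          unfold Rdiv; rewrite Rmult_assoc, Rinv_l by lra.
          assert (eta * d * d <= eta * d * Rabs (u x y)) by (apply Rmult_le_compat_l; nra).
          unfold e; replace (eta * d ^ 2) with (eta * d * d) by ring.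
          pose proof (Rmult_le_pos (eta * d) (eta * d ^ 2)); nra. }
        apply Rle_trans with (eta * d * / d).
        - apply Rmult_le_compat; lra.
        - right; field; lra. }
      specialize (HV x y); apply Rmult_le_compat; lra. }
    pose proof (Rle_0_sqr (phix x y - k x y * ux x y * phi x y)) as S1.
    pose proof (Rle_0_sqr (phiy x y - k x y * uy x y * phi x y)) as S2.
    unfold Rsqr in S1, S2; specialize (Hlap x y); unfold D1, D2.
    assert (Hk : (uxx x y + uyy x y) * (k x y * phi x y ^ 2)
                 = - V x y * u x y * (k x y * phi x y ^ 2)) by (rewrite Hlap; ring).
    lra.
Qed.

(** * The stability form on odd functions *)

(** The Euclidean |grad N|^2 of inverse stereographic projection: twice its conformal factor 4 / (1
    + |z|^2)^2. *)
Definition gauss_potential (x y : R) : R := 8 / (1 + x ^ 2 + y ^ 2) ^ 2.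

(* The linear function (a, b, c) of the point of the sphere with stereographic coordinate
   x + iy. *)
Definition sphere_linear (a b c x y : R) : R :=
  (2 * a * x + 2 * b * y + c * (x ^ 2 + y ^ 2 - 1)) / (1 + x ^ 2 + y ^ 2).

Definition sphere_linear_x (a b c x y : R) : R :=
  (2 * a + 2 * c * x) / (1 + x ^ 2 + y ^ 2)
  - 2 * x * (2 * a * x + 2 * b * y + c * (x ^ 2 + y ^ 2 - 1)) / (1 + x ^ 2 + y ^ 2) ^ 2.

Definition sphere_linear_xx (a b c x y : R) : R :=
  2 * c / (1 + x ^ 2 + y ^ 2)
  - 2 * (2 * x * (2 * a + 2 * c * x)) / (1 + x ^ 2 + y ^ 2) ^ 2
  - 2 * (2 * a * x + 2 * b * y + c * (x ^ 2 + y ^ 2 - 1)) / (1 + x ^ 2 + y ^ 2) ^ 2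
  + 8 * x ^ 2 * (2 * a * x + 2 * b * y + c * (x ^ 2 + y ^ 2 - 1)) / (1 + x ^ 2 + y ^ 2) ^ 3.

(** Exchanging the axes exchanges a and b, so the y-derivatives are the x-derivative formulas with
    swapped arguments. *)
Lemma sphere_linear_swap a b c x y : sphere_linear a b c x y = sphere_linear b a c y x.
Proof. unfold sphere_linear; f_equal; ring. Qed.

Lemma one_plus_sqr_pos x y : 0 < 1 + x ^ 2 + y ^ 2.
Proof. nra. Qed.

Lemma is_derive_sphere_linear a b c x y :
  is_derive (fun t => sphere_linear a b c t y) x (sphere_linear_x a b c x y).
Proof.
  unfold sphere_linear, sphere_linear_x; pose proof (one_plus_sqr_pos x y).
  auto_derive; [simpl in *; lra|field; lra].
Qed.

Lemma is_derive_sphere_linear_x a b c x y :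
  is_derive (fun t => sphere_linear_x a b c t y) x (sphere_linear_xx a b c x y).
Proof.
  unfold sphere_linear_x, sphere_linear_xx; pose proof (one_plus_sqr_pos x y).
  auto_derive.
  - repeat split; trivial; try (simpl in *; lra).
    simpl in *; apply Rgt_not_eq; nra.
  - field; lra.
Qed.

(** Linear functions are eigenfunctions of the Laplacian of the unit sphere with eigenvalue 2;
    stereographic projection multiplies this by 4 / (1 + |z|^2)^2. *)
Lemma sphere_linear_laplace a b c x y :
  sphere_linear_xx a b c x y + sphere_linear_xx b a c y x
  = - gauss_potential x y * sphere_linear a b c x y.
Proof.
  unfold sphere_linear, sphere_linear_xx, gauss_potential.
  pose proof (one_plus_sqr_pos x y); pose proof (one_plus_sqr_pos y x).
  field; lra.
Qed.

Lemma cont2_div f g : cont2 f -> cont2 g -> (forall x y, g x y <> 0) ->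
  cont2 (fun x y => f x y / g x y).
Proof. intros Hf Hg Hn; apply cont2_mult; [|apply cont2_inv]; trivial. Qed.

Lemma cont2_pow f n : cont2 f -> cont2 (fun x y => f x y ^ n).
Proof.
  intros Hf; induction n as [|n IH]; [exact (cont2_const 1)|exact (cont2_mult _ _ Hf IH)].
Qed.

#[export] Hint Resolve cont2_div cont2_pow : cont2.

Lemma one_plus_sqr_neq x y : 1 + x ^ 2 + y ^ 2 <> 0.
Proof. apply Rgt_not_eq, one_plus_sqr_pos. Qed.

#[export] Hint Resolve one_plus_sqr_neq pow_nonzero : cont2.

Lemma cont2_sphere_linear a b c : cont2 (sphere_linear a b c).
Proof. unfold sphere_linear; auto 20 with cont2. Qed.

Lemma cont2_sphere_linear_x a b c : cont2 (sphere_linear_x a b c).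
Proof. unfold sphere_linear_x; auto 20 with cont2. Qed.

Lemma cont2_sphere_linear_xx a b c : cont2 (sphere_linear_xx a b c).
Proof. unfold sphere_linear_xx; auto 20 with cont2. Qed.

Lemma cont2_gauss_potential : cont2 gauss_potential.
Proof. unfold gauss_potential; auto 20 with cont2. Qed.

Lemma gauss_potential_bound x y : 0 <= gauss_potential x y <= 8.
Proof.
  unfold gauss_potential; set (s := (1 + x ^ 2 + y ^ 2) ^ 2).
  assert (Hs : 1 <= s) by (unfold s; pose proof (pow2_ge_0 x); pose proof (pow2_ge_0 y); nra).
  split; [apply Rlt_le, Rdiv_lt_0_compat; lra|].
  apply Rmult_le_reg_r with s; [lra|].
  unfold Rdiv; rewrite Rmult_assoc, Rinv_l by lra; lra.
Qed.

(** * Even and odd parts under the reflections of the axes *)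

Definition C1_supported (M : R) (phi phix phiy : R -> R -> R) : Prop :=
  (cont2 phi /\ cont2 phix /\ cont2 phiy) /\
  (forall x y, is_derive (fun t => phi t y) x (phix x y)) /\
  (forall x y, is_derive (fun t => phi x t) y (phiy x y)) /\
  (forall x y, M <= Rabs x \/ M <= Rabs y -> phi x y = 0).

Definition stability_form (M : R) (phi phix phiy : R -> R -> R) : R :=
  square_integral M (fun x y => phix x y ^ 2 + phiy x y ^ 2 - gauss_potential x y * phi x y ^ 2).

Lemma stability_form_nonneg_of_zero_set M a b c phi phix phiy :
  0 < M -> C1_supported M phi phix phiy ->
  (forall x y, sphere_linear a b c x y = 0 -> phi x y = 0) ->
  0 <= stability_form M phi phix phiy.
Proof.
  intros HM ((c0 & c1 & c2) & d1 & d2 & Hs) H0.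
  apply (dirichlet_potential_nonneg M 8 gauss_potential (sphere_linear a b c)
    (sphere_linear_x a b c) (fun x y => sphere_linear_x b a c y x)
    (sphere_linear_xx a b c) (fun x y => sphere_linear_xx b a c y x)); trivial.
  - apply cont2_gauss_potential.
  - apply cont2_sphere_linear.
  - apply cont2_sphere_linear_x.
  - apply cont2_swap, cont2_sphere_linear_x.
  - apply cont2_sphere_linear_xx.
  - apply cont2_swap, cont2_sphere_linear_xx.
  - intros; apply is_derive_sphere_linear.
  - intros x y; apply is_derive_ext with (fun t => sphere_linear b a c t x).
    + intros; apply sphere_linear_swap.
    + apply is_derive_sphere_linear.
  - intros; apply is_derive_sphere_linear_x.
  - intros x y; apply is_derive_sphere_linear_x.
  - intros; apply sphere_linear_laplace.
  - apply gauss_potential_bound.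
Qed.

Definition sym_x (s : R) (f : R -> R -> R) (x y : R) : R := (f x y + s * f (- x) y) / 2.
Definition sym_y (s : R) (f : R -> R -> R) (x y : R) : R := (f x y + s * f x (- y)) / 2.

Lemma cont2_sym_x s f : cont2 f -> cont2 (sym_x s f).
Proof.
  intros Hf; pose proof (cont2_reflect_x f Hf); unfold sym_x, Rdiv; auto with cont2.
Qed.

Lemma cont2_sym_y s f : cont2 f -> cont2 (sym_y s f).
Proof.
  intros Hf; pose proof (cont2_reflect_y f Hf); unfold sym_y, Rdiv; auto with cont2.
Qed.

Lemma is_derive_reflect (f : R -> R) x d :
  is_derive f (- x) d -> is_derive (fun t => f (- t)) x (- d).
Proof.
  intros Hf.
  replace (- d) with (scal (-1) d) by (unfold scal; simpl; unfold mult; simpl; ring).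
  apply (is_derive_comp f Ropp); trivial.
  auto_derive; trivial.
Qed.

Lemma is_derive_sym (f g : R -> R) s x df dg :
  is_derive f x df -> is_derive g x dg ->
  is_derive (fun t => (f t + s * g t) / 2) x ((df + s * dg) / 2).
Proof.
  intros Hf Hg.
  auto_derive.
  - repeat split; eexists; eassumption.
  - change (Derive (fun t => f t) x) with (Derive f x).
    change (Derive (fun t => g t) x) with (Derive g x).
    rewrite (is_derive_unique _ _ _ Hf), (is_derive_unique _ _ _ Hg); field.
Qed.

(** Differentiation in x reverses the parity in x, hence the sign [- s]; differentiation in y keeps
    it. *)
Lemma C1_supported_sym_x M s phi phix phiy :
  C1_supported M phi phix phiy ->
  C1_supported M (sym_x s phi) (sym_x (- s) phix) (sym_x s phiy).
Proof.
  intros ((c0 & c1 & c2) & d1 & d2 & Hs); split; [|split; [|split]].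
  - auto using cont2_sym_x.
  - intros x y; unfold sym_x.
    replace (_ / 2) with ((phix x y + s * - phix (- x) y) / 2) by field.
    apply (is_derive_sym (fun t => phi t y) (fun t => phi (- t) y)); trivial.
    apply (is_derive_reflect (fun t => phi t y)); trivial.
  - intros x y; now apply (is_derive_sym (fun t => phi x t) (fun t => phi (- x) t)).
  - intros x y H; unfold sym_x; rewrite !Hs; rewrite ?Rabs_Ropp; trivial; field.
Qed.

Lemma C1_supported_sym_y M s phi phix phiy :
  C1_supported M phi phix phiy ->
  C1_supported M (sym_y s phi) (sym_y s phix) (sym_y (- s) phiy).
Proof.
  intros ((c0 & c1 & c2) & d1 & d2 & Hs); split; [|split; [|split]].
  - auto using cont2_sym_y.
  - intros x y; now apply (is_derive_sym (fun t => phi t y) (fun t => phi t (- y))).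
  - intros x y; unfold sym_y.
    replace (_ / 2) with ((phiy x y + s * - phiy x (- y)) / 2) by field.
    apply (is_derive_sym (fun t => phi x t) (fun t => phi x (- t))); trivial.
    apply (is_derive_reflect (fun t => phi x t)); trivial.
  - intros x y H; unfold sym_y; rewrite !Hs; rewrite ?Rabs_Ropp; trivial; field.
Qed.

(* Parallelogram law: the form is invariant under the reflections. *)
Lemma stability_form_split_x M phi phix phiy :
  0 < M -> C1_supported M phi phix phiy ->
  stability_form M phi phix phiy
  = stability_form M (sym_x 1 phi) (sym_x (- (1)) phix) (sym_x 1 phiy)
    + stability_form M (sym_x (-1) phi) (sym_x (- (-1)) phix) (sym_x (-1) phiy).
Proof.
  intros HM ((c0 & c1 & c2) & _).
  pose (q := fun x y => phix x y ^ 2 + phiy x y ^ 2 - gauss_potential x y * phi x y ^ 2).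
  pose proof cont2_gauss_potential as cg.
  assert (cq : cont2 q) by (unfold q; auto with cont2).
  pose proof (cont2_reflect_x _ cq) as cq'.
  unfold stability_form.
  rewrite <- square_integral_plus; trivial;
    [|pose proof (cont2_sym_x 1 _ c0); pose proof (cont2_sym_x (- (1)) _ c1);
      pose proof (cont2_sym_x 1 _ c2); auto with cont2
     |pose proof (cont2_sym_x (-1) _ c0); pose proof (cont2_sym_x (- (-1)) _ c1);
      pose proof (cont2_sym_x (-1) _ c2); auto with cont2].
  (* Pointwise, the densities of the two parts add up to the mean of q and its reflection: the cross
     terms cancel. The reflected half has the same integral. *)
  transitivity (square_integral M (fun x y => / 2 * q x y + / 2 * q (- x) y)).
  - rewrite square_integral_plus, !square_integral_scal, square_integral_reflect_x;
      auto with cont2.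
    unfold q; field.
  - apply square_integral_ext; intros x y; unfold q, sym_x.
    replace (gauss_potential (- x) y) with (gauss_potential x y)
      by (unfold gauss_potential; do 3 f_equal; ring).
    field.
Qed.

Lemma stability_form_split_y M phi phix phiy :
  0 < M -> C1_supported M phi phix phiy ->
  stability_form M phi phix phiy
  = stability_form M (sym_y 1 phi) (sym_y 1 phix) (sym_y (- (1)) phiy)
    + stability_form M (sym_y (-1) phi) (sym_y (-1) phix) (sym_y (- (-1)) phiy).
Proof.
  intros HM ((c0 & c1 & c2) & _).
  pose (q := fun x y => phix x y ^ 2 + phiy x y ^ 2 - gauss_potential x y * phi x y ^ 2).
  pose proof cont2_gauss_potential as cg.
  assert (cq : cont2 q) by (unfold q; auto with cont2).
  pose proof (cont2_reflect_y _ cq) as cq'.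
  unfold stability_form.
  rewrite <- square_integral_plus; trivial;
    [|pose proof (cont2_sym_y 1 _ c0); pose proof (cont2_sym_y 1 _ c1);
      pose proof (cont2_sym_y (- (1)) _ c2); auto with cont2
     |pose proof (cont2_sym_y (-1) _ c0); pose proof (cont2_sym_y (-1) _ c1);
      pose proof (cont2_sym_y (- (-1)) _ c2); auto with cont2].
  transitivity (square_integral M (fun x y => / 2 * q x y + / 2 * q x (- y))).
  - rewrite square_integral_plus, !square_integral_scal, square_integral_reflect_y;
      auto with cont2.
    unfold q; field.
  - apply square_integral_ext; intros x y; unfold q, sym_y.
    replace (gauss_potential x (- y)) with (gauss_potential x y)
      by (unfold gauss_potential; do 3 f_equal; ring).
    field.
Qed.

Lemma stability_form_nonneg M phi phix phiy :
  0 < M -> C1_supported M phi phix phiy ->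
  (forall x y, x ^ 2 + y ^ 2 = 1 -> phi (- x) (- y) = - phi x y) ->
  0 <= stability_form M phi phix phiy.
Proof.
  intros HM Hphi Hodd.
  rewrite stability_form_split_x by trivial.
  apply Rplus_le_le_0_compat.
  - rewrite stability_form_split_y by (trivial; now apply C1_supported_sym_x).
    apply Rplus_le_le_0_compat.
    (* Even in both variables: the third coordinate of the sphere vanishes exactly on the unit
       circle, where the four values cancel in antipodal pairs. *)
    + apply stability_form_nonneg_of_zero_set with 0 0 1; trivial.
      { now apply C1_supported_sym_y, C1_supported_sym_x. }
      intros x y Hz; unfold sphere_linear in Hz.
      assert (H1 : x ^ 2 + y ^ 2 = 1).
      { pose proof (one_plus_sqr_pos x y) as Hp.
        apply Rmult_eq_compat_r with (r := 1 + x ^ 2 + y ^ 2) in Hz.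
        unfold Rdiv in Hz; rewrite Rmult_assoc, Rinv_l in Hz by lra; lra. }
      unfold sym_y, sym_x.
      pose proof (Hodd x y H1) as E1; pose proof (Hodd (- x) y) as E2.
      rewrite Ropp_involutive in E2; rewrite E1, E2; [lra|].
      replace ((- x) ^ 2) with (x ^ 2) by ring; trivial.
    (* Even in x and odd in y: the second coordinate vanishes on the x-axis. *)
    + apply stability_form_nonneg_of_zero_set with 0 1 0; trivial.
      { now apply C1_supported_sym_y, C1_supported_sym_x. }
      intros x y Hz; unfold sphere_linear in Hz.
      assert (H1 : y = 0).
      { pose proof (one_plus_sqr_pos x y) as Hp.
        apply Rmult_eq_compat_r with (r := 1 + x ^ 2 + y ^ 2) in Hz.
        unfold Rdiv in Hz; rewrite Rmult_assoc, Rinv_l in Hz by lra; lra. }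
      unfold sym_y; subst y; rewrite Ropp_0; field.
  (* Odd in x: the first coordinate vanishes on the y-axis, and no splitting in y is made. *)
  - apply stability_form_nonneg_of_zero_set with 1 0 0; trivial.
    { now apply C1_supported_sym_x. }
    intros x y Hz; unfold sphere_linear in Hz.
    assert (H1 : x = 0).
    { pose proof (one_plus_sqr_pos x y) as Hp.
      apply Rmult_eq_compat_r with (r := 1 + x ^ 2 + y ^ 2) in Hz.
      unfold Rdiv in Hz; rewrite Rmult_assoc, Rinv_l in Hz by lra; lra. }
    unfold sym_x; subst x; rewrite Ropp_0; field.
Qed.

(** * Holomorphic functions along curves *)

Definition is_curve_derive (w : R -> C) (t : R) (v : C) : Prop :=
  is_derive (fun s => fst (w s)) t (fst v) /\ is_derive (fun s => snd (w s)) t (snd v).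

Lemma is_curve_derive_ext_loc w1 w2 t v :
  locally t (fun s => w1 s = w2 s) -> is_curve_derive w1 t v -> is_curve_derive w2 t v.
Proof.
  intros H [H1 H2]; split; eapply is_derive_ext_loc; try eassumption.
  - revert H; apply filter_imp; now intros s ->.
  - revert H; apply filter_imp; now intros s ->.
Qed.

Lemma is_curve_derive_const a t : is_curve_derive (fun _ => a) t 0.
Proof. split; apply (is_derive_const (V := R_NormedModule)). Qed.

Lemma is_curve_derive_plus w1 w2 t v1 v2 :
  is_curve_derive w1 t v1 -> is_curve_derive w2 t v2 ->
  is_curve_derive (fun s => w1 s + w2 s)%C t (v1 + v2)%C.
Proof. intros [H1 H2] [H3 H4]; split; now apply (is_derive_plus (V := R_NormedModule)). Qed.

Lemma is_derive_mult_R (f g : R -> R) x df dg :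
  is_derive f x df -> is_derive g x dg ->
  is_derive (fun t => f t * g t) x (df * g x + f x * dg).
Proof. intros Hf Hg; apply (is_derive_mult f g x df dg Hf Hg Rmult_comm). Qed.

Lemma is_curve_derive_mult w1 w2 t v1 v2 :
  is_curve_derive w1 t v1 -> is_curve_derive w2 t v2 ->
  is_curve_derive (fun s => w1 s * w2 s)%C t (v1 * w2 t + w1 t * v2)%C.
Proof.
  intros [H1 H2] [H3 H4]; split; simpl.
  - replace (_ + _) with ((fst v1 * fst (w2 t) + fst (w1 t) * fst v2)
      - (snd v1 * snd (w2 t) + snd (w1 t) * snd v2)) by ring.
    apply (is_derive_minus (V := R_NormedModule)); now apply is_derive_mult_R.
  - replace (_ + _) with ((fst v1 * snd (w2 t) + fst (w1 t) * snd v2)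
      + (snd v1 * fst (w2 t) + snd (w1 t) * fst v2)) by ring.
    apply (is_derive_plus (V := R_NormedModule)); now apply is_derive_mult_R.
Qed.

Definition normsq (z : C) : R := fst z ^ 2 + snd z ^ 2.

Lemma normsq_pos (z : C) : z <> 0%C -> 0 < normsq z.
Proof.
  intros Hz; unfold normsq; destruct z as [x y]; simpl.
  destruct (Req_dec x 0) as [->|Hx]; [|nra].
  destruct (Req_dec y 0) as [->|Hy]; [exfalso; now apply Hz|nra].
Qed.

Lemma normsq_mult (z w : C) : normsq (z * w)%C = normsq z * normsq w.
Proof. unfold normsq; simpl; ring. Qed.

Lemma normsq_inv (z : C) : z <> 0%C -> normsq (/ z)%C = / normsq z.
Proof.
  intros Hz; pose proof (normsq_pos z Hz) as Hp; unfold normsq in *; simpl in *.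
  field; lra.
Qed.

Lemma normsq_pow (z : C) n : normsq (z ^ n)%C = normsq z ^ n.
Proof.
  induction n as [|n IH]; [unfold normsq; simpl; ring|].
  rewrite Cpow_S, normsq_mult, IH; reflexivity.
Qed.

Lemma is_curve_derive_inv (w : R -> C) t v :
  w t <> 0%C -> is_curve_derive w t v ->
  is_curve_derive (fun s => / w s)%C t (- (/ w t * / w t) * v)%C.
Proof.
  intros Hn [H1 H2]; pose proof (normsq_pos _ Hn) as Hp; unfold normsq in Hp.
  assert (E1 : is_derive (fun s => / (fst (w s) ^ 2 + snd (w s) ^ 2)) t
     (- (2 * fst (w t) * fst v + 2 * snd (w t) * snd v)
        / (fst (w t) ^ 2 + snd (w t) ^ 2) ^ 2)).
  { apply (is_derive_inv (fun s => fst (w s) ^ 2 + snd (w s) ^ 2)); [|lra].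
    apply (is_derive_plus (V := R_NormedModule)).
    - replace (2 * fst (w t) * fst v) with (INR 2 * fst v * fst (w t) ^ 1) by (simpl; ring).
      now apply (is_derive_pow (fun s => fst (w s)) 2).
    - replace (2 * snd (w t) * snd v) with (INR 2 * snd v * snd (w t) ^ 1) by (simpl; ring).
      now apply (is_derive_pow (fun s => snd (w s)) 2). }
  split.
  - pose proof (is_derive_mult_R _ _ t _ _ H1 E1) as E.
    eapply (eq_rect _ (is_derive _ t) E); simpl; field; simpl in *; lra.
  - pose proof (is_derive_mult_R _ _ t _ _ (is_derive_opp (V := R_NormedModule) _ t _ H2) E1) as E.
    unfold opp in E; simpl in E.
    eapply (eq_rect _ (is_derive _ t) E); simpl; field; simpl in *; lra.
Qed.

(* The complex chain rule along every differentiable curve through z; this contains the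
   Cauchy-Riemann equations. *)
Definition curve_hol (P : C -> C) (d z : C) : Prop :=
  forall c t v, c t = z -> is_curve_derive c t v -> is_curve_derive (fun s => P (c s)) t (d * v)%C.

Lemma is_curve_derive_eq w t v v' : v = v' -> is_curve_derive w t v -> is_curve_derive w t v'.
Proof. now intros ->. Qed.

Lemma curve_hol_eq P d d' z : d = d' -> curve_hol P d z -> curve_hol P d' z.
Proof. now intros ->. Qed.

Lemma curve_hol_const a z : curve_hol (fun _ => a) 0%C z.
Proof.
  intros c t v _ _; apply is_curve_derive_eq with (RtoC 0); [ring|apply is_curve_derive_const].
Qed.

Lemma curve_hol_id z : curve_hol (fun w => w) 1%C z.
Proof. intros c t v _ H; apply is_curve_derive_eq with v; [ring|exact H]. Qed.

Lemma curve_hol_plus P Q d e z :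
  curve_hol P d z -> curve_hol Q e z -> curve_hol (fun w => P w + Q w)%C (d + e)%C z.
Proof.
  intros H1 H2 c t v Hc Hv; apply is_curve_derive_eq with (d * v + e * v)%C; [ring|].
  apply is_curve_derive_plus; auto.
Qed.

Lemma curve_hol_mult P Q d e z :
  curve_hol P d z -> curve_hol Q e z ->
  curve_hol (fun w => P w * Q w)%C (d * Q z + P z * e)%C z.
Proof.
  intros H1 H2 c t v Hc Hv; subst z.
  apply is_curve_derive_eq with ((d * v) * Q (c t) + P (c t) * (e * v))%C; [ring|].
  apply (is_curve_derive_mult (fun s => P (c s)) (fun s => Q (c s))); auto.
Qed.

Lemma curve_hol_scal a P d z : curve_hol P d z -> curve_hol (fun w => a * P w)%C (a * d)%C z.
Proof.
  intros H; apply curve_hol_eq with (RtoC 0 * P z + a * d)%C; [ring|].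
  apply (curve_hol_mult (fun _ => a)); [apply curve_hol_const|trivial].
Qed.

Lemma curve_hol_opp P d z : curve_hol P d z -> curve_hol (fun w => - P w)%C (- d)%C z.
Proof.
  intros H c t v Hc Hv; destruct (H c t v Hc Hv) as [H1 H2]; split; simpl in *.
  - replace (_ - _) with (- (fst d * fst v - snd d * snd v)) by ring.
    now apply (is_derive_opp (V := R_NormedModule)).
  - replace (_ + _) with (- (fst d * snd v + snd d * fst v)) by ring.
    now apply (is_derive_opp (V := R_NormedModule)).
Qed.

Lemma curve_hol_minus P Q d e z :
  curve_hol P d z -> curve_hol Q e z -> curve_hol (fun w => P w - Q w)%C (d - e)%C z.
Proof. intros H1 H2; apply curve_hol_plus; [|apply curve_hol_opp]; trivial. Qed.

Lemma curve_hol_inv (z : C) : z <> 0%C -> curve_hol (fun w => / w)%C (- (/ z * / z))%C z.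
Proof. intros Hz c t v Hc Hv; subst z; now apply is_curve_derive_inv. Qed.

Lemma curve_hol_pow P d z n :
  curve_hol P d z -> curve_hol (fun w => P w ^ n)%C (INR n * P z ^ (pred n) * d)%C z.
Proof.
  intros H; induction n as [|n IH].
  - apply curve_hol_eq with (RtoC 0); [simpl; ring|apply (curve_hol_const 1)].
  - eapply curve_hol_eq; [|exact (curve_hol_mult _ _ _ _ _ H IH)].
    cbn beta; destruct n as [|n];
      [change (INR 1) with 1; change (INR 0) with 0; simpl Nat.pred; ring|].
    rewrite (S_INR (S n)), RtoC_plus; simpl Nat.pred; rewrite Cpow_S; ring.
Qed.

Lemma curve_hol_ext_loc P Q d z :
  locally_2d (fun x y => P (x, y) = Q (x, y)) (fst z) (snd z) ->
  curve_hol P d z -> curve_hol Q d z.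
Proof.
  intros [e He] H c t v Hc Hv; apply is_curve_derive_ext_loc with (fun s => P (c s)); [|now apply H].
  destruct Hv as [H1 H2].
  assert (C1 : continuous (fun s => fst (c s)) t)
    by (apply (ex_derive_continuous (V := R_NormedModule)); eexists; exact H1).
  assert (C2 : continuous (fun s => snd (c s)) t)
    by (apply (ex_derive_continuous (V := R_NormedModule)); eexists; exact H2).
  assert (L1 : locally t (fun s => ball (fst (c t)) e (fst (c s))))
    by (apply (C1 (ball (fst (c t)) e)), locally_ball).
  assert (L2 : locally t (fun s => ball (snd (c t)) e (snd (c s))))
    by (apply (C2 (ball (snd (c t)) e)), locally_ball).
  generalize (filter_and _ _ L1 L2); apply filter_imp; intros s [B1 B2].
  rewrite Hc in B1, B2; rewrite (surjective_pairing (c s)); now apply He.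
Qed.

(** Stated on coordinates because [ex_diff_n], hence [Cn_at], asks for [continuity_2d_pt]. *)
Definition complex_cont (P : C -> C) (z : C) : Prop :=
  continuity_2d_pt (fun x y => fst (P (x, y))) (fst z) (snd z) /\
  continuity_2d_pt (fun x y => snd (P (x, y))) (fst z) (snd z).

Lemma complex_cont_const a z : complex_cont (fun _ => a) z.
Proof. split; apply continuity_2d_pt_const. Qed.

Lemma complex_cont_id z : complex_cont (fun w => w) z.
Proof. split; simpl; [apply continuity_2d_pt_id1|apply continuity_2d_pt_id2]. Qed.

Lemma complex_cont_plus P Q z :
  complex_cont P z -> complex_cont Q z -> complex_cont (fun w => P w + Q w)%C z.
Proof. intros [H1 H2] [H3 H4]; split; now apply continuity_2d_pt_plus. Qed.

Lemma complex_cont_opp P z : complex_cont P z -> complex_cont (fun w => - P w)%C z.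
Proof. intros [H1 H2]; split; now apply continuity_2d_pt_opp. Qed.

Lemma complex_cont_minus P Q z :
  complex_cont P z -> complex_cont Q z -> complex_cont (fun w => P w - Q w)%C z.
Proof. intros H1 H2; apply complex_cont_plus; [|apply complex_cont_opp]; trivial. Qed.

Lemma complex_cont_mult P Q z :
  complex_cont P z -> complex_cont Q z -> complex_cont (fun w => P w * Q w)%C z.
Proof.
  intros [H1 H2] [H3 H4]; split; simpl.
  - apply continuity_2d_pt_minus; now apply continuity_2d_pt_mult.
  - apply continuity_2d_pt_plus; now apply continuity_2d_pt_mult.
Qed.

Lemma complex_cont_pow P z n : complex_cont P z -> complex_cont (fun w => P w ^ n)%C z.
Proof.
  intros H; induction n as [|n IH]; [apply (complex_cont_const 1)|now apply complex_cont_mult].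
Qed.

Lemma complex_cont_inv (z : C) : z <> 0%C -> complex_cont (fun w => / w)%C z.
Proof.
  intros Hz; pose proof (normsq_pos z Hz) as Hp; unfold normsq in Hp.
  assert (H : continuity_2d_pt (fun x y => / (x ^ 2 + y ^ 2)) (fst z) (snd z)).
  { apply continuity_2d_pt_inv; [|lra].
    apply (cont2_plus (fun x y => x ^ 2) (fun x y => y ^ 2)); auto with cont2. }
  split; simpl; unfold Rdiv; (apply continuity_2d_pt_mult; [|exact H]).
  - apply continuity_2d_pt_id1.
  - apply continuity_2d_pt_opp, continuity_2d_pt_id2.
Qed.

#[export] Hint Resolve complex_cont_const complex_cont_id complex_cont_plus complex_cont_minus
  complex_cont_opp complex_cont_mult complex_cont_pow complex_cont_inv : cont2.

(** * Partial derivatives of real parts of holomorphic functions *)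

Lemma is_derive_re_x P d z : curve_hol P d z ->
  is_derive (fun x => fst (P (x, snd z))) (fst z) (fst d).
Proof.
  intros H.
  assert (Hc : is_curve_derive (fun x => (x, snd z)) (fst z) 1)
    by (split; simpl; auto_derive; trivial).
  destruct (H _ _ _ (eq_sym (surjective_pairing z)) Hc) as [H1 _]; simpl in H1.
  now replace (fst d) with (fst d * 1 - snd d * 0) by ring.
Qed.

(** The vertical line has velocity i, and Re (i d) = - Im d. *)
Lemma is_derive_re_y P d z : curve_hol P d z ->
  is_derive (fun y => fst (P (fst z, y))) (snd z) (- snd d).
Proof.
  intros H.
  assert (Hc : is_curve_derive (fun y => (fst z, y)) (snd z) Ci)
    by (split; simpl; auto_derive; trivial).
  destruct (H _ _ _ (eq_sym (surjective_pairing z)) Hc) as [H1 _]; simpl in H1.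
  now replace (- snd d) with (fst d * 0 - snd d * 1) by ring.
Qed.

Lemma locally_2d_nonzero (z : C) :
  z <> 0%C -> locally_2d (fun x y => (x, y) <> 0%C :> C) (fst z) (snd z).
Proof.
  intros Hz; pose proof (normsq_pos z Hz) as Hp; unfold normsq in Hp.
  assert (Hc : cont2 (fun x y => x ^ 2 + y ^ 2)) by auto with cont2.
  pose proof (continuity_2d_pt_neq_0 _ _ _ (Hc (fst z) (snd z)) ltac:(lra)) as H.
  revert H; apply locally_2d_impl, locally_2d_forall; intros x y Hn He.
  injection He as -> ->; apply Hn; simpl; ring.
Qed.

(** The constant k absorbs the translation left free by [is_Re_integral]. The class is closed under
    [dx] and [dy], which permits induction on the order of differentiability. *)
Definition re_plus_const (h : C -> R) (P : C -> C) : Prop :=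
  exists k, forall w : C, w <> 0%C -> h w = fst (P w) + k.

Lemma is_derive_re_plus_const_x h P d (z : C) : z <> 0%C -> re_plus_const h P -> curve_hol P d z ->
  is_derive (fun x => h (x, snd z)) (fst z) (fst d).
Proof.
  intros Hz [k Hk] Hd.
  apply is_derive_ext_loc with (fun x => fst (P (x, snd z)) + k).
  - generalize (locally_2d_1d_const_y _ _ _ (locally_2d_nonzero z Hz)).
    apply filter_imp; intros x Hx; symmetry; now apply Hk.
  - replace (fst d) with (fst d + 0) by ring.
    apply (is_derive_plus (V := R_NormedModule));
      [now apply is_derive_re_x|apply (is_derive_const (V := R_NormedModule))].
Qed.

Lemma is_derive_re_plus_const_y h P d (z : C) : z <> 0%C -> re_plus_const h P -> curve_hol P d z ->
  is_derive (fun y => h (fst z, y)) (snd z) (- snd d).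
Proof.
  intros Hz [k Hk] Hd.
  apply is_derive_ext_loc with (fun y => fst (P (fst z, y)) + k).
  - generalize (locally_2d_1d_const_x _ _ _ (locally_2d_nonzero z Hz)).
    apply filter_imp; intros x Hx; symmetry; now apply Hk.
  - replace (- snd d) with (- snd d + 0) by ring.
    apply (is_derive_plus (V := R_NormedModule));
      [now apply is_derive_re_y|apply (is_derive_const (V := R_NormedModule))].
Qed.

Lemma dx_re_plus_const h P d (z : C) : z <> 0%C -> re_plus_const h P -> curve_hol P d z ->
  dx h z = fst d.
Proof. intros; apply is_derive_unique; eapply is_derive_re_plus_const_x; eassumption. Qed.

Lemma dy_re_plus_const h P d (z : C) : z <> 0%C -> re_plus_const h P -> curve_hol P d z ->
  dy h z = - snd d.
Proof. intros; apply is_derive_unique; eapply is_derive_re_plus_const_y; eassumption. Qed.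

Lemma re_plus_const_dx h P Q : re_plus_const h P ->
  (forall w : C, w <> 0%C -> curve_hol P (Q w) w) -> re_plus_const (dx h) Q.
Proof.
  intros H HQ; exists 0; intros w Hw.
  rewrite (dx_re_plus_const h P (Q w)); auto; ring.
Qed.

(** The y-derivative - Im Q is rewritten as Re (i Q) to stay in the class. *)
Lemma re_plus_const_dy h P Q : re_plus_const h P ->
  (forall w : C, w <> 0%C -> curve_hol P (Q w) w) -> re_plus_const (dy h) (fun w => Ci * Q w)%C.
Proof.
  intros H HQ; exists 0; intros w Hw.
  rewrite (dy_re_plus_const h P (Q w)); auto; simpl; ring.
Qed.

(** T is the tower of successive complex derivatives of T 0. In the induction [dx] shifts the tower,
    and [dy] shifts it and multiplies it by i. *)
Lemma re_plus_const_Cn n : forall (T : nat -> C -> C) h,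
  (forall k (w : C), (k < n)%nat -> w <> 0%C -> curve_hol (T k) (T (S k) w) w) ->
  (forall k (w : C), (k <= n)%nat -> w <> 0%C -> complex_cont (T k) w) ->
  re_plus_const h (T 0%nat) -> forall z : C, z <> 0%C -> Cn_at n h z.
Proof.
  unfold Cn_at; induction n as [|n IH]; intros T h HT HC Hh z Hz.
  all: assert (Hc : continuity_2d_pt (fun x y => h (x, y)) (fst z) (snd z)).
  1, 3: destruct Hh as [k Hk];
    apply continuity_2d_pt_ext_loc with (fun x y => fst (T 0%nat (x, y)) + k);
    [generalize (locally_2d_nonzero z Hz); apply locally_2d_impl, locally_2d_forall;
     intros x y Hw; symmetry; now apply Hk
    |apply continuity_2d_pt_plus; [apply HC; [lia|trivial]|apply continuity_2d_pt_const]].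
  - now split.
  - split; [exact Hc|].
    assert (H0 : forall w : C, w <> 0%C -> curve_hol (T 0%nat) (T 1%nat w) w)
      by (intros; apply HT; [lia|trivial]).
    split; [|split; [|split]].
    + eexists; now apply (is_derive_re_plus_const_x h _ _ z Hz Hh (H0 z Hz)).
    + eexists; now apply (is_derive_re_plus_const_y h _ _ z Hz Hh (H0 z Hz)).
    + apply (IH (fun k => T (S k)) (dx h)); trivial.
      * intros k w Hk; apply HT; lia.
      * intros k w Hk; apply HC; lia.
      * now apply re_plus_const_dx with (T 0%nat).
    + apply (IH (fun k w => Ci * T (S k) w)%C (dy h)); trivial.
      * intros k w Hk Hw; apply curve_hol_scal, HT; [lia|trivial].
      * intros k w Hk Hw; apply complex_cont_mult; [apply complex_cont_const|apply HC; [lia|trivial]].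
      * now apply re_plus_const_dy with (T 0%nat).
Qed.

(** * Line integrals in the punctured plane *)

Lemma C1_curve_derive c t : C1_curve c -> is_curve_derive c t (velocity c t).
Proof. intros H; destruct (H t) as (H1 & H2 & _); split; now apply Derive_correct. Qed.

Lemma continuous_of_is_derive (f : R -> R) t d : is_derive f t d -> continuous f t.
Proof. intros H; apply (ex_derive_continuous (V := R_NormedModule)); now exists d. Qed.

(** The fundamental theorem along the arc. Differentiability of phi is there to make the integrand
    continuous. *)
Lemma re_line_integral P phi c a b :
  a <= b -> C1_curve c ->
  (forall t, a <= t <= b -> curve_hol P (phi (c t)) (c t)) ->
  (forall t, a <= t <= b -> exists d, curve_hol phi d (c t)) ->
  is_Re_line_integral phi c a b (fst (P (c b)) - fst (P (c a))).
Proof.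
  intros Hab Hc HP Hphi; unfold is_Re_line_integral.
  apply (is_RInt_derive (V := R_CompleteNormedModule) (fun t => fst (P (c t))));
    rewrite Rmin_left, Rmax_right by trivial; intros t Ht.
  - now apply (HP t Ht c t); [|apply C1_curve_derive].
  - destruct (Hphi t Ht) as [d Hd].
    destruct (Hd c t _ eq_refl (C1_curve_derive c t Hc)) as [H1 H2].
    destruct (Hc t) as (_ & _ & V1 & V2).
    simpl; apply (continuous_minus (V := R_NormedModule)).
    + apply (continuous_mult (K := R_AbsRing)); trivial; eapply continuous_of_is_derive, H1.
    + apply (continuous_mult (K := R_AbsRing)); trivial; eapply continuous_of_is_derive, H2.
Qed.

Lemma C1_segment p q : C1_curve (fun t => (p * (1 - t)%R + q * t)%C).
Proof.
  intros t; unfold velocity; simpl.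
  assert (E1 : forall s, is_derive (fun t => fst p * (1 - t) - snd p * 0 + (fst q * t - snd q * 0))
    s (fst q - fst p)) by (intros s; auto_derive; trivial; ring).
  assert (E2 : forall s, is_derive (fun t => fst p * 0 + snd p * (1 - t) + (fst q * 0 + snd q * t))
    s (snd q - snd p)) by (intros s; auto_derive; trivial; ring).
  split; [eexists; apply E1|split; [eexists; apply E2|split]].
  - apply continuous_ext with (fun _ => fst q - fst p);
      [intros s; symmetry; apply is_derive_unique, E1|apply continuous_const].
  - apply continuous_ext with (fun _ => snd q - snd p);
      [intros s; symmetry; apply is_derive_unique, E2|apply continuous_const].
Qed.

(** Points off the nonpositive real axis are joined to 1 by a segment avoiding 0; real points are
    joined to i, which has already been reached. *)
Lemma const_on_punctured_plane (d : C -> R) :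
  (forall c a b, a <= b -> C1_curve c -> (forall t, a <= t <= b -> c t <> 0%C) ->
     d (c b) = d (c a)) ->
  forall z : C, z <> 0%C -> d z = d 1%C.
Proof.
  intros H.
  assert (Hseg : forall p q : C, (forall t, 0 <= t <= 1 -> (p * (1 - t)%R + q * t)%C <> 0%C) ->
    d q = d p).
  { intros p q Hpq.
    pose proof (H _ 0 1 Rle_0_1 (C1_segment p q) Hpq) as E; cbv beta in E.
    replace (p * (1 - 1)%R + q * 1)%C with q in E
      by (destruct p, q; apply injective_projections; simpl; ring).
    replace (p * (1 - 0)%R + q * 0)%C with p in E
      by (destruct p, q; apply injective_projections; simpl; ring).
    exact E. }
  assert (Hi : forall z, snd z <> 0 \/ 0 < fst z -> d z = d 1%C).
  { intros z Hz; apply Hseg; intros t Ht E.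
    apply (f_equal fst) in E as E1; apply (f_equal snd) in E as E2; simpl in E1, E2.
    destruct Hz as [Hz|Hz]; [|nra].
    assert (Ht0 : t = 0) by (apply Rmult_eq_reg_l with (snd z); lra).
    subst t; lra. }
  intros z Hz; destruct (Req_dec (snd z) 0) as [Hy|Hy]; [|apply Hi; now left].
  rewrite <- (Hi Ci) by (left; simpl; lra).
  apply Hseg; intros t Ht E.
  apply (f_equal fst) in E as E1; apply (f_equal snd) in E as E2; simpl in E1, E2.
  rewrite Hy in E2; assert (Ht0 : t = 1) by lra.
  subst t; apply Hz, injective_projections; simpl; lra.
Qed.

(** * The Weierstrass integral *)

(** Primitive of a (w^(p-1) - w^(-q-1)). Each of f, z f and z^2 f has this form with p, q >= 1, so
    no logarithm appears. *)
Definition laurent_primitive (a : C) (p q : nat) (w : C) : C :=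
  (a * (w ^ p / INR p + (/ w) ^ q / INR q))%C.

Lemma RtoC_INR_neq n : (1 <= n)%nat -> RtoC (INR n) <> 0%C.
Proof. intros Hn E; apply RtoC_inj in E; apply (not_0_INR n); [lia|exact E]. Qed.

Lemma curve_hol_laurent_primitive a p q (z : C) :
  (1 <= p)%nat -> (1 <= q)%nat -> z <> 0%C ->
  curve_hol (laurent_primitive a p q) (a * (z ^ (p - 1) - (/ z) ^ (q + 1)))%C z.
Proof.
  intros Hp Hq Hz; unfold laurent_primitive.
  apply curve_hol_scal.
  pose proof (RtoC_INR_neq p Hp) as Np; pose proof (RtoC_INR_neq q Hq) as Nq.
  assert (H1 : curve_hol (fun w => / INR p * w ^ p)%C (/ INR p * (INR p * z ^ pred p * 1))%C z)
    by apply curve_hol_scal, (curve_hol_pow (fun w => w)), curve_hol_id.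
  assert (H2 : curve_hol (fun w => / INR q * (/ w) ^ q)%C
    (/ INR q * (INR q * (/ z) ^ pred q * - (/ z * / z)))%C z)
    by now apply curve_hol_scal, (curve_hol_pow (fun w => / w)%C), curve_hol_inv.
  eapply curve_hol_ext_loc; [|eapply curve_hol_eq; [|exact (curve_hol_plus _ _ _ _ _ H1 H2)]].
  - apply locally_2d_forall; intros x y; unfold Cdiv; ring.
  - destruct p as [|p]; [lia|]; destruct q as [|q]; [lia|].
    replace (S p - 1)%nat with p by lia; replace (S q + 1)%nat with (S (S q)) by lia.
    simpl pred; rewrite !Cpow_S.
    field; auto.
Qed.

Definition f_laurent (m : nat) (z : C) : C := (Ci ^ (m - 1) * (z ^ (m - 1) - (/ z) ^ (m + 3)))%C.

(** Left in the shape produced by [curve_hol_pow]. For m = 1 the truncated exponent [pred 0] is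
    harmless, its coefficient being [INR 0]. *)
Definition df_laurent (m : nat) (z : C) : C :=
  (Ci ^ (m - 1) * (INR (m - 1) * z ^ pred (m - 1) * 1
                   - INR (m + 3) * (/ z) ^ pred (m + 3) * - (/ z * / z)))%C.

Lemma f_data_laurent m (z : C) : (1 <= m)%nat -> z <> 0%C -> f_data m z = f_laurent m z.
Proof.
  intros Hm Hz; unfold f_data, f_laurent.
  replace (2 * m + 2)%nat with ((m - 1) + (m + 3))%nat by lia.
  rewrite Cpow_inv by trivial; rewrite (Cpow_add_r z (m - 1) (m + 3)).
  field; now apply Cpow_nz.
Qed.

Lemma curve_hol_f_laurent m (z : C) : z <> 0%C -> curve_hol (f_laurent m) (df_laurent m z) z.
Proof.
  intros Hz; apply curve_hol_scal, curve_hol_minus.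
  - apply (curve_hol_pow (fun w => w)), curve_hol_id.
  - now apply (curve_hol_pow (fun w => / w)%C), curve_hol_inv.
Qed.

Lemma curve_hol_f_data m (z : C) :
  (1 <= m)%nat -> z <> 0%C -> curve_hol (f_data m) (df_laurent m z) z.
Proof.
  intros Hm Hz; apply curve_hol_ext_loc with (f_laurent m); [|now apply curve_hol_f_laurent].
  generalize (locally_2d_nonzero z Hz); apply locally_2d_impl, locally_2d_forall.
  intros x y Hw; symmetry; now apply f_data_laurent.
Qed.

Definition prim_f (m : nat) : C -> C := laurent_primitive (Ci ^ (m - 1))%C m (m + 2).
Definition prim_zf (m : nat) : C -> C := laurent_primitive (Ci ^ (m - 1))%C (m + 1) (m + 1).
Definition prim_z2f (m : nat) : C -> C := laurent_primitive (Ci ^ (m - 1))%C (m + 2) m.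

Lemma curve_hol_prim_f m (z : C) :
  (1 <= m)%nat -> z <> 0%C -> curve_hol (prim_f m) (f_data m z) z.
Proof.
  intros Hm Hz; eapply curve_hol_eq; [|apply curve_hol_laurent_primitive; trivial; lia].
  rewrite f_data_laurent by trivial; unfold f_laurent.
  now replace (m + 2 + 1)%nat with (m + 3)%nat by lia.
Qed.

Lemma curve_hol_prim_zf m (z : C) :
  (1 <= m)%nat -> z <> 0%C -> curve_hol (prim_zf m) (z * f_data m z)%C z.
Proof.
  intros Hm Hz; eapply curve_hol_eq; [|apply curve_hol_laurent_primitive; trivial; lia].
  rewrite f_data_laurent by trivial; unfold f_laurent.
  replace (m + 1 + 1)%nat with (m + 2)%nat by lia.
  replace (m + 1 - 1)%nat with (S (m - 1))%nat by lia.
  replace (m + 3)%nat with (S (m + 2))%nat by lia; rewrite !Cpow_S.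
  field; trivial.
Qed.

Lemma curve_hol_prim_z2f m (z : C) :
  (1 <= m)%nat -> z <> 0%C -> curve_hol (prim_z2f m) (z ^ 2 * f_data m z)%C z.
Proof.
  intros Hm Hz; eapply curve_hol_eq; [|apply curve_hol_laurent_primitive; trivial; lia].
  rewrite f_data_laurent by trivial; unfold f_laurent.
  replace (m + 2 - 1)%nat with (S (S (m - 1)))%nat by lia.
  replace (m + 3)%nat with (S (S (m + 1)))%nat by lia; rewrite !Cpow_S.
  field; trivial.
Qed.

Definition prim1 (m : nat) (z : C) : C := (/ 2 * (prim_f m z - prim_z2f m z))%C.
Definition prim2 (m : nat) (z : C) : C := (Ci / 2 * (prim_f m z + prim_z2f m z))%C.

(** The Weierstrass forms for g(z) = z, with f abstract so that the local geometry can be computed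
    without its formula. *)
Definition phi1 (f : C -> C) (z : C) : C := (/ 2 * (1 - z ^ 2) * f z)%C.
Definition phi2 (f : C -> C) (z : C) : C := (Ci / 2 * (1 + z ^ 2) * f z)%C.
Definition phi3 (f : C -> C) (z : C) : C := (z * f z)%C.

Lemma curve_hol_prim1 m (z : C) :
  (1 <= m)%nat -> z <> 0%C -> curve_hol (prim1 m) (phi1 (f_data m) z) z.
Proof.
  intros Hm Hz; eapply curve_hol_eq;
    [|apply curve_hol_scal, curve_hol_minus; [now apply curve_hol_prim_f|now apply curve_hol_prim_z2f]].
  unfold phi1; ring.
Qed.

Lemma curve_hol_prim2 m (z : C) :
  (1 <= m)%nat -> z <> 0%C -> curve_hol (prim2 m) (phi2 (f_data m) z) z.
Proof.
  intros Hm Hz; eapply curve_hol_eq;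
    [|apply curve_hol_scal, curve_hol_plus; [now apply curve_hol_prim_f|now apply curve_hol_prim_z2f]].
  unfold phi2; ring.
Qed.

Definition dphi1 (f df : C -> C) (z : C) : C := (/ 2 * ((1 - z ^ 2) * df z - 2 * z * f z))%C.
Definition dphi2 (f df : C -> C) (z : C) : C := (Ci / 2 * ((1 + z ^ 2) * df z + 2 * z * f z))%C.
Definition dphi3 (f df : C -> C) (z : C) : C := (z * df z + f z)%C.

Lemma curve_hol_sqr z : curve_hol (fun w => w ^ 2)%C (2 * z)%C z.
Proof.
  eapply curve_hol_eq; [|apply (curve_hol_pow (fun w => w)), curve_hol_id].
  change (INR 2) with 2; simpl pred; rewrite Cpow_1_r; ring.
Qed.

Lemma curve_hol_phi1 (f df : C -> C) z :
  curve_hol f (df z) z -> curve_hol (phi1 f) (dphi1 f df z) z.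
Proof.
  intros H; eapply curve_hol_eq.
  2: { apply curve_hol_mult; [|exact H].
       apply curve_hol_scal, curve_hol_minus; [apply curve_hol_const|apply curve_hol_sqr]. }
  unfold dphi1; ring.
Qed.

Lemma curve_hol_phi2 (f df : C -> C) z :
  curve_hol f (df z) z -> curve_hol (phi2 f) (dphi2 f df z) z.
Proof.
  intros H; eapply curve_hol_eq.
  2: { apply curve_hol_mult; [|exact H].
       apply curve_hol_scal, curve_hol_plus; [apply curve_hol_const|apply curve_hol_sqr]. }
  unfold dphi2; ring.
Qed.

Lemma curve_hol_phi3 (f df : C -> C) z :
  curve_hol f (df z) z -> curve_hol (phi3 f) (dphi3 f df z) z.
Proof.
  intros H; eapply curve_hol_eq.
  2: { apply curve_hol_mult; [apply curve_hol_id|exact H]. }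
  unfold dphi3; ring.
Qed.

Definition weierstrass_X (m : nat) (z : C) : R3 :=
  (fst (prim1 m z), fst (prim2 m z), fst (prim_zf m z)).

Lemma weierstrass_X_integral m : (1 <= m)%nat ->
  is_Re_integral punctured_plane (weierstrass_forms g_data (f_data m)) (weierstrass_X m).
Proof.
  intros Hm c a b Hab Hc HD.
  assert (Hf : forall t, a <= t <= b -> curve_hol (f_data m) (df_laurent m (c t)) (c t))
    by (intros; apply curve_hol_f_data; trivial; now apply HD).
  split; [|split].
  - apply (re_line_integral (prim1 m) (phi1 (f_data m))); trivial; intros t Ht.
    + apply curve_hol_prim1; trivial; now apply HD.
    + exists (dphi1 (f_data m) (df_laurent m) (c t)); now apply curve_hol_phi1, Hf.
  - apply (re_line_integral (prim2 m) (phi2 (f_data m))); trivial; intros t Ht.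
    + apply curve_hol_prim2; trivial; now apply HD.
    + exists (dphi2 (f_data m) (df_laurent m) (c t)); now apply curve_hol_phi2, Hf.
  - apply (re_line_integral (prim_zf m) (phi3 (f_data m))); trivial; intros t Ht.
    + apply curve_hol_prim_zf; trivial; now apply HD.
    + exists (dphi3 (f_data m) (df_laurent m) (c t)); now apply curve_hol_phi3, Hf.
Qed.

Lemma Re_integral_coord phi c a b v w :
  is_Re_line_integral phi c a b v -> is_Re_line_integral phi c a b w -> v = w.
Proof.
  intros Hv Hw; apply (is_RInt_unique (V := R_CompleteNormedModule)) in Hv.
  apply (is_RInt_unique (V := R_CompleteNormedModule)) in Hw; congruence.
Qed.

(** X and [weierstrass_X] have the same increments along every arc, so each coordinate of their
    difference is constant. *)
Lemma Re_integral_eq m X : (1 <= m)%nat ->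
  is_Re_integral punctured_plane (weierstrass_forms g_data (f_data m)) X ->
  re_plus_const (fun z => pr1 (X z)) (prim1 m) /\
  re_plus_const (fun z => pr2 (X z)) (prim2 m) /\
  re_plus_const (fun z => pr3 (X z)) (prim_zf m).
Proof.
  intros Hm HX; pose proof (weierstrass_X_integral m Hm) as HY.
  assert (H : forall (p : R3 -> R), (p = pr1 \/ p = pr2 \/ p = pr3) -> forall z : C, z <> 0%C ->
    p (X z) - p (weierstrass_X m z) = p (X 1%C) - p (weierstrass_X m 1%C)).
  { intros p Hp; apply (const_on_punctured_plane (fun z => p (X z) - p (weierstrass_X m z))).
    intros c a b Hab Hc HD.
    destruct (HX c a b Hab Hc HD) as (X1 & X2 & X3).
    destruct (HY c a b Hab Hc HD) as (Y1 & Y2 & Y3).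
    destruct Hp as [-> | [-> | -> ] ].
    - pose proof (Re_integral_coord _ _ _ _ _ _ X1 Y1); lra.
    - pose proof (Re_integral_coord _ _ _ _ _ _ X2 Y2); lra.
    - pose proof (Re_integral_coord _ _ _ _ _ _ X3 Y3); lra. }
  split; [|split]; eexists; intros w Hw.
  - pose proof (H pr1 ltac:(auto) w Hw) as E; unfold pr1 in E at 2; simpl in E.
    instantiate (1 := pr1 (X 1%C) - pr1 (weierstrass_X m 1%C)); simpl; lra.
  - pose proof (H pr2 ltac:(auto) w Hw) as E; unfold pr2 in E at 2; simpl in E.
    instantiate (1 := pr2 (X 1%C) - pr2 (weierstrass_X m 1%C)); simpl; lra.
  - pose proof (H pr3 ltac:(auto) w Hw) as E; unfold pr3 in E at 2; simpl in E.
    instantiate (1 := pr3 (X 1%C) - pr3 (weierstrass_X m 1%C)); simpl; lra.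
Qed.

(** * Invariance under the antipodal map *)

Lemma antipodal_inv (z : C) : antipodal z = (- / Cconj z)%C.
Proof. unfold antipodal; f_equal; unfold Cdiv; ring. Qed.

Lemma Cconj_neq (z : C) : z <> 0%C -> Cconj z <> 0%C.
Proof.
  intros Hz E; apply Hz; apply (f_equal fst) in E as E1; apply (f_equal snd) in E as E2.
  apply injective_projections; simpl in *; lra.
Qed.

Lemma laurent_primitive_conj a p q (z : C) :
  z <> 0%C -> Cconj (laurent_primitive a p q z) = laurent_primitive (Cconj a) p q (Cconj z).
Proof.
  intros Hz; unfold laurent_primitive.
  assert (Hr : forall n, Cconj (/ INR n) = (/ INR n)%C).
  { intros n; apply injective_projections; simpl; unfold Rdiv; ring. }
  unfold Cdiv; rewrite Cmult_conj, Cplus_conj, !Cmult_conj, !Cpow_conj, !Hr, Cinv_conj by trivial.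
  reflexivity.
Qed.

Lemma laurent_primitive_inv a p q (z : C) :
  z <> 0%C -> laurent_primitive a p q (/ z)%C = laurent_primitive a q p z.
Proof.
  intros Hz; unfold laurent_primitive.
  replace (/ / z)%C with z by (field; trivial); ring.
Qed.

Lemma Copp_pow (z : C) n : ((- z) ^ n = (-1) ^ n * z ^ n)%C.
Proof. replace (- z)%C with ((-1) * z)%C by ring; apply Cpow_mult_l. Qed.

Lemma minus_one_pow_add (p q : nat) : Nat.even (p + q) = true -> ((-1) ^ p = (-1) ^ q :> C)%C.
Proof.
  intros H; apply Nat.even_spec in H; destruct H as [k Hk].
  assert (E : forall n, ((-1) ^ n * (-1) ^ n)%C = 1%C :> C).
  { intros n; rewrite <- Cpow_mult_l; replace (-1 * -1)%C with (RtoC 1) by ring; apply Cpow_1_l. }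
  assert (E2 : ((-1) ^ p * (-1) ^ q)%C = 1%C :> C).
  { rewrite <- Cpow_add_r, Hk; replace (2 * k)%nat with (k + k)%nat by lia.
    rewrite Cpow_add_r; apply E. }
  rewrite <- (Cmult_1_r ((-1) ^ p)%C), <- (E q), Cmult_assoc, E2; ring.
Qed.

Lemma laurent_primitive_opp a p q (z : C) :
  z <> 0%C -> Nat.even (p + q) = true ->
  laurent_primitive a p q (- z)%C = laurent_primitive (a * (-1) ^ p)%C p q z.
Proof.
  intros Hz H; unfold laurent_primitive.
  replace (/ - z)%C with (- / z)%C.
  - rewrite (Copp_pow z), (Copp_pow (/ z)), (minus_one_pow_add p q H); unfold Cdiv; ring.
  - field; trivial.
Qed.

Lemma Ci_pow_conj n : Cconj (Ci ^ n) = ((-1) ^ n * Ci ^ n)%C.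
Proof.
  rewrite Cpow_conj, <- Cpow_mult_l; f_equal; apply injective_projections; simpl; ring.
Qed.

(** The antipodal map is conjugation, inversion and negation. Conjugation contributes (-1)^n through
    i^n, inversion exchanges p and q, and negation contributes (-1)^p because both exponents have
    the same parity. *)
Lemma laurent_primitive_antipodal n p q (z : C) :
  z <> 0%C -> Nat.even (p + q) = true ->
  laurent_primitive (Ci ^ n)%C p q (antipodal z)
  = ((-1) ^ (n + p) * Cconj (laurent_primitive (Ci ^ n) q p z))%C.
Proof.
  intros Hz H; pose proof (Cconj_neq z Hz) as Hc.
  assert (Hi : (/ Cconj z)%C <> 0%C).
  { intros E; apply (f_equal (fun w => w * Cconj z)%C) in E.
    rewrite Cinv_l in E by trivial; apply (f_equal fst) in E; simpl in E; lra. }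
  rewrite antipodal_inv, laurent_primitive_opp, laurent_primitive_inv, laurent_primitive_conj,
    Ci_pow_conj, Cpow_add_r by trivial.
  unfold laurent_primitive.
  assert (E : ((-1) ^ n * (-1) ^ n)%C = 1%C :> C).
  { rewrite <- Cpow_mult_l; replace (-1 * -1)%C with (RtoC 1) by ring; apply Cpow_1_l. }
  transitivity (((-1) ^ n * (-1) ^ n) * (Ci ^ n * (-1) ^ p *
    (Cconj z ^ q / INR q + (/ Cconj z) ^ p / INR p)))%C; [rewrite E; ring|ring].
Qed.

Lemma minus_one_pow_even n : Nat.even n = true -> ((-1) ^ n)%C = 1%C :> C.
Proof. intros H; apply (minus_one_pow_add n 0); now rewrite Nat.add_0_r. Qed.

Lemma minus_one_pow_odd n : Nat.even n = false -> ((-1) ^ n)%C = (-1)%C :> C.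
Proof.
  intros H; rewrite (minus_one_pow_add n 1), Cpow_1_r; trivial.
  rewrite Nat.add_1_r, Nat.even_succ, <- Nat.negb_even, H; reflexivity.
Qed.

Lemma even_double n : Nat.even (2 * n) = true.
Proof. apply Nat.even_spec; now exists n. Qed.

(** The factor i^(m-1) of the data gives the signs: n + p is odd for f and z^2 f, which are
    exchanged, and even for z f. Hence [prim1], [prim2] and [prim_zf] all go to their conjugates,
    with the same real parts; for [prim2] the minus sign is absorbed by conjugating i/2. *)
Lemma weierstrass_X_antipodal m (z : C) :
  (1 <= m)%nat -> z <> 0%C -> weierstrass_X m (antipodal z) = weierstrass_X m z.
Proof.
  intros Hm Hz.
  assert (E0 : prim_f m (antipodal z) = (- Cconj (prim_z2f m z))%C).
  { unfold prim_f, prim_z2f; rewrite laurent_primitive_antipodal, minus_one_pow_odd; trivial.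
    - ring.
    - replace (m - 1 + m)%nat with (2 * (m - 1) + 1)%nat by lia.
      now rewrite Nat.add_1_r, Nat.even_succ, <- Nat.negb_even, even_double.
    - replace (m + (m + 2))%nat with (2 * (m + 1))%nat by lia; apply even_double. }
  assert (E1 : prim_zf m (antipodal z) = Cconj (prim_zf m z)).
  { unfold prim_zf; rewrite laurent_primitive_antipodal, minus_one_pow_even; trivial.
    - ring.
    - replace (m - 1 + (m + 1))%nat with (2 * m)%nat by lia; apply even_double.
    - replace (m + 1 + (m + 1))%nat with (2 * (m + 1))%nat by lia; apply even_double. }
  assert (E2 : prim_z2f m (antipodal z) = (- Cconj (prim_f m z))%C).
  { unfold prim_f, prim_z2f; rewrite laurent_primitive_antipodal, minus_one_pow_odd; trivial.
    - ring.
    - replace (m - 1 + (m + 2))%nat with (2 * m + 1)%nat by lia.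
      now rewrite Nat.add_1_r, Nat.even_succ, <- Nat.negb_even, even_double.
    - replace (m + 2 + m)%nat with (2 * (m + 1))%nat by lia; apply even_double. }
  unfold weierstrass_X, prim1, prim2; rewrite E0, E1, E2.
  generalize (prim_f m z) (prim_z2f m z) (prim_zf m z); intros F0 F2 F1.
  apply injective_projections; [apply injective_projections|]; simpl; field; lra.
Qed.

(** * Geometry of the surface *)

(** What the local geometry uses of X: holomorphic f with derivative df, and coordinates that are
    real parts of primitives of the forms, up to constants. *)
Definition weierstrass_map (f df : C -> C) (X : C -> R3) : Prop :=
  (forall z : C, z <> 0%C -> curve_hol f (df z) z /\ complex_cont f z /\ complex_cont df z) /\
  exists P1 P2 P3 : C -> C,
    re_plus_const (fun z => pr1 (X z)) P1 /\
    re_plus_const (fun z => pr2 (X z)) P2 /\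
    re_plus_const (fun z => pr3 (X z)) P3 /\
    forall z : C, z <> 0%C ->
      (curve_hol P1 (phi1 f z) z /\ complex_cont P1 z) /\
      (curve_hol P2 (phi2 f z) z /\ complex_cont P2 z) /\
      (curve_hol P3 (phi3 f z) z /\ complex_cont P3 z).

Lemma complex_cont_laurent_primitive a p q (z : C) :
  z <> 0%C -> complex_cont (laurent_primitive a p q) z.
Proof.
  intros Hz; unfold laurent_primitive, Cdiv.
  apply complex_cont_mult; [apply complex_cont_const|].
  apply complex_cont_plus; apply complex_cont_mult; try apply complex_cont_const.
  - apply complex_cont_pow, complex_cont_id.
  - now apply complex_cont_pow, complex_cont_inv.
Qed.

Lemma complex_cont_ext_nonzero (P Q : C -> C) (z : C) : z <> 0%C ->
  (forall w : C, w <> 0%C -> P w = Q w) -> complex_cont P z -> complex_cont Q z.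
Proof.
  intros Hz H [H1 H2]; split.
  - eapply continuity_2d_pt_ext_loc; [|exact H1].
    generalize (locally_2d_nonzero z Hz); apply locally_2d_impl, locally_2d_forall.
    intros x y Hw; now rewrite H.
  - eapply continuity_2d_pt_ext_loc; [|exact H2].
    generalize (locally_2d_nonzero z Hz); apply locally_2d_impl, locally_2d_forall.
    intros x y Hw; now rewrite H.
Qed.

Lemma Re_integral_weierstrass_map m X : (1 <= m)%nat ->
  is_Re_integral punctured_plane (weierstrass_forms g_data (f_data m)) X ->
  weierstrass_map (f_data m) (df_laurent m) X.
Proof.
  intros Hm HX; split.
  - intros z Hz; split; [now apply curve_hol_f_data|split].
    + apply complex_cont_ext_nonzero with (f_laurent m); trivial.
      * intros; symmetry; now apply f_data_laurent.
      * unfold f_laurent; auto 20 with cont2.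
    + unfold df_laurent; auto 30 with cont2.
  - destruct (Re_integral_eq m X Hm HX) as (H1 & H2 & H3).
    exists (prim1 m), (prim2 m), (prim_zf m); do 3 (split; [assumption|]).
    intros z Hz; split; [|split]; split.
    + now apply curve_hol_prim1.
    + apply complex_cont_mult; [apply complex_cont_const|].
      apply complex_cont_minus; now apply complex_cont_laurent_primitive.
    + now apply curve_hol_prim2.
    + apply complex_cont_mult; [apply complex_cont_const|].
      apply complex_cont_plus; now apply complex_cont_laurent_primitive.
    + now apply curve_hol_prim_zf.
    + now apply complex_cont_laurent_primitive.
Qed.

Lemma weierstrass_map_first f df X (z : C) : weierstrass_map f df X -> z <> 0%C ->
  Dx X z = (fst (phi1 f z), fst (phi2 f z), fst (phi3 f z)) /\
  Dy X z = (- snd (phi1 f z), - snd (phi2 f z), - snd (phi3 f z)).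
Proof.
  intros [_ (P1 & P2 & P3 & H1 & H2 & H3 & H)] Hz.
  destruct (H z Hz) as ([D1 _] & [D2 _] & [D3 _]); unfold Dx, Dy, map3.
  rewrite (dx_re_plus_const _ _ _ z Hz H1 D1), (dx_re_plus_const _ _ _ z Hz H2 D2),
    (dx_re_plus_const _ _ _ z Hz H3 D3).
  now rewrite (dy_re_plus_const _ _ _ z Hz H1 D1), (dy_re_plus_const _ _ _ z Hz H2 D2),
    (dy_re_plus_const _ _ _ z Hz H3 D3).
Qed.

Lemma second_derivatives h P Q dQ (z : C) : z <> 0%C -> re_plus_const h P ->
  (forall w : C, w <> 0%C -> curve_hol P (Q w) w) -> curve_hol Q dQ z ->
  dx (dx h) z = fst dQ /\ dx (dy h) z = - snd dQ /\ dy (dy h) z = - fst dQ.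
Proof.
  intros Hz H HP HQ.
  pose proof (re_plus_const_dx h P Q H HP) as Hx.
  pose proof (re_plus_const_dy h P Q H HP) as Hy.
  pose proof (curve_hol_scal Ci Q dQ z HQ) as HQ'.
  rewrite (dx_re_plus_const _ _ _ z Hz Hx HQ), (dx_re_plus_const _ _ _ z Hz Hy HQ'),
    (dy_re_plus_const _ _ _ z Hz Hy HQ'); simpl; repeat split; ring.
Qed.

Lemma weierstrass_map_second f df X (z : C) : weierstrass_map f df X -> z <> 0%C ->
  Dx (Dx X) z = (fst (dphi1 f df z), fst (dphi2 f df z), fst (dphi3 f df z)) /\
  Dx (Dy X) z = (- snd (dphi1 f df z), - snd (dphi2 f df z), - snd (dphi3 f df z)) /\
  Dy (Dy X) z = (- fst (dphi1 f df z), - fst (dphi2 f df z), - fst (dphi3 f df z)).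
Proof.
  intros [Hf (P1 & P2 & P3 & H1 & H2 & H3 & H)] Hz.
  destruct (Hf z Hz) as [Df _].
  destruct (second_derivatives _ P1 (phi1 f) (dphi1 f df z) z Hz H1) as (A1 & A2 & A3);
    [intros w Hw; apply H, Hw|now apply curve_hol_phi1|].
  destruct (second_derivatives _ P2 (phi2 f) (dphi2 f df z) z Hz H2) as (B1 & B2 & B3);
    [intros w Hw; apply H, Hw|now apply curve_hol_phi2|].
  destruct (second_derivatives _ P3 (phi3 f) (dphi3 f df z) z Hz H3) as (C1 & C2 & C3);
    [intros w Hw; apply H, Hw|now apply curve_hol_phi3|].
  split; [|split].
  - change ((dx (dx (fun w => pr1 (X w))) z, dx (dx (fun w => pr2 (X w))) z,
      dx (dx (fun w => pr3 (X w))) z) = (fst (dphi1 f df z), fst (dphi2 f df z), fst (dphi3 f df z))).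
    now rewrite A1, B1, C1.
  - change ((dx (dy (fun w => pr1 (X w))) z, dx (dy (fun w => pr2 (X w))) z,
      dx (dy (fun w => pr3 (X w))) z) = (- snd (dphi1 f df z), - snd (dphi2 f df z), - snd (dphi3 f df z))).
    now rewrite A2, B2, C2.
  - change ((dy (dy (fun w => pr1 (X w))) z, dy (dy (fun w => pr2 (X w))) z,
      dy (dy (fun w => pr3 (X w))) z) = (- fst (dphi1 f df z), - fst (dphi2 f df z), - fst (dphi3 f df z))).
    now rewrite A3, B3, C3.
Qed.

Lemma harmonic_of_hol h P (Q dQ : C -> C) : re_plus_const h P ->
  (forall w : C, w <> 0%C -> curve_hol P (Q w) w /\ complex_cont P w) ->
  (forall w : C, w <> 0%C -> curve_hol Q (dQ w) w /\ complex_cont Q w /\ complex_cont dQ w) ->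
  harmonic_on punctured_plane h.
Proof.
  intros Hh HP HQ z Hz; split.
  - apply (re_plus_const_Cn 2
      (fun k => match k with 0%nat => P | 1%nat => Q | _ => dQ end)); trivial.
    + intros [|[|k]] w Hk Hw; [apply HP|apply HQ|lia]; trivial.
    + intros [|[|[|k]]] w Hk Hw; [apply HP|apply HQ|apply HQ|lia]; trivial.
  - destruct (second_derivatives h P Q (dQ z) z Hz Hh) as (-> & _ & ->);
      [intros w Hw; now apply HP|now apply HQ|ring].
Qed.

Lemma weierstrass_map_harmonic f df X : weierstrass_map f df X ->
  coordinatewise (harmonic_on punctured_plane) X.
Proof.
  intros [Hf (P1 & P2 & P3 & H1 & H2 & H3 & H)]; split; [|split].
  - apply harmonic_of_hol with P1 (phi1 f) (dphi1 f df); trivial; intros w Hw.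
    + now apply H.
    + destruct (Hf w Hw) as (D & C0 & C1); split; [now apply curve_hol_phi1|].
      unfold phi1, dphi1; auto 20 with cont2.
  - apply harmonic_of_hol with P2 (phi2 f) (dphi2 f df); trivial; intros w Hw.
    + now apply H.
    + destruct (Hf w Hw) as (D & C0 & C1); split; [now apply curve_hol_phi2|].
      unfold phi2, dphi2; auto 20 with cont2.
  - apply harmonic_of_hol with P3 (phi3 f) (dphi3 f df); trivial; intros w Hw.
    + now apply H.
    + destruct (Hf w Hw) as (D & C0 & C1); split; [now apply curve_hol_phi3|].
      unfold phi3, dphi3; auto 20 with cont2.
Qed.

(** The density of ds^2 = (1/4) (1 + |g|^2)^2 |omega|^2 for g(z) = z. *)
Definition conformal_factor (f : C -> C) (z : C) : R := / 4 * (1 + normsq z) ^ 2 * normsq (f z).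

Lemma weierstrass_map_metric f df X (z : C) : weierstrass_map f df X -> z <> 0%C ->
  EE X z = conformal_factor f z /\ FF X z = 0 /\ GG X z = conformal_factor f z.
Proof.
  intros HX Hz; unfold EE, FF, GG; destruct (weierstrass_map_first f df X z HX Hz) as [-> ->].
  unfold conformal_factor, phi1, phi2, phi3, normsq, dot, pr1, pr2, pr3.
  generalize (f z); intros [a b]; destruct z as [x y]; simpl.
  split; [|split]; field.
Qed.

Lemma metric_det_conformal X z E : EE X z = E -> FF X z = 0 -> GG X z = E -> metric_det X z = E ^ 2.
Proof. intros H1 H2 H3; unfold metric_det; rewrite H1, H2, H3; ring. Qed.

Lemma weierstrass_map_conformal f df X :
  weierstrass_map f df X -> conformal_on punctured_plane X.
Proof.
  intros HX z Hz; destruct (weierstrass_map_metric f df X z HX Hz) as (E & F & G).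
  unfold EE, FF, GG in *; now rewrite E, F, G.
Qed.

(** By conformality |a X_x + b X_y|^2 is a^2 + b^2 times the conformal factor, which is positive
    where f is nonzero. *)
Lemma weierstrass_map_branch_point f df X (z : C) : weierstrass_map f df X ->
  branch_point punctured_plane X z -> z <> 0%C /\ f z = 0%C.
Proof.
  intros HX [Hz Hb]; split; trivial; apply NNPP; intros Hf; apply Hb; intros a b Hab.
  destruct (weierstrass_map_metric f df X z HX Hz) as (E & F & G).
  assert (Hp : 0 < conformal_factor f z).
  { unfold conformal_factor; pose proof (normsq_pos _ Hf); pose proof (normsq_pos _ Hz).
    apply Rmult_lt_0_compat; trivial; nra. }
  assert (H : (a ^ 2 + b ^ 2) * conformal_factor f z = 0).
  { set (v := add3 (scale3 a (Dx X z)) (scale3 b (Dy X z))) in Hab.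
    transitivity (dot v v); [|rewrite Hab; unfold dot, pr1, pr2, pr3; simpl; ring].
    transitivity (a ^ 2 * EE X z + 2 * a * b * FF X z + b ^ 2 * GG X z); [rewrite E, F, G; ring|].
    unfold v, EE, FF, GG, dot, add3, scale3, pr1, pr2, pr3; simpl; ring. }
  apply Rmult_integral in H; destruct H as [H|H]; [|lra].
  pose proof (pow2_ge_0 a); pose proof (pow2_ge_0 b).
  split; apply Rsqr_0_uniq; unfold Rsqr; nra.
Qed.

Lemma weierstrass_map_normal f df X (z : C) : weierstrass_map f df X -> z <> 0%C -> f z <> 0%C ->
  unit_normal X z = (2 * fst z / (1 + normsq z), 2 * snd z / (1 + normsq z),
                     (normsq z - 1) / (1 + normsq z)).
Proof.
  intros HX Hz Hf; destruct (weierstrass_map_metric f df X z HX Hz) as (E & F & G).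
  pose proof (normsq_pos _ Hf) as Pf; pose proof (normsq_pos _ Hz) as Pz.
  assert (Hp : 0 < conformal_factor f z)
    by (unfold conformal_factor; apply Rmult_lt_0_compat; trivial; nra).
  unfold unit_normal; rewrite (metric_det_conformal X z _ E F G), sqrt_pow2 by lra.
  destruct (weierstrass_map_first f df X z HX Hz) as [-> ->].
  unfold conformal_factor, phi1, phi2, phi3, normsq, cross, scale3, pr1, pr2, pr3 in *.
  revert Hf Pf Hp; generalize (f z); intros [a b]; destruct z as [x y]; simpl in *; intros.
  apply injective_projections; [apply injective_projections|]; simpl; field;
    repeat split; simpl in *; nra.
Qed.

(** The second fundamental form is - Re (f dg dz) with dg = dz. The terms containing df are
    multiples of the forms themselves, hence tangential, and drop out. *)
Lemma weierstrass_map_h f df X (z : C) : weierstrass_map f df X -> z <> 0%C -> f z <> 0%C ->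
  h11 X z = - fst (f z) /\ h12 X z = snd (f z) /\ h22 X z = fst (f z).
Proof.
  intros HX Hz Hf; unfold h11, h12, h22.
  rewrite (weierstrass_map_normal f df X z HX Hz Hf).
  destruct (weierstrass_map_second f df X z HX Hz) as (-> & -> & ->).
  pose proof (normsq_pos _ Hz) as Pz.
  unfold dphi1, dphi2, dphi3, normsq, dot, pr1, pr2, pr3 in *.
  generalize (f z) (df z); intros [a b] [p q]; destruct z as [x y]; simpl in *.
  split; [|split]; field; lra.
Qed.

(** The gradient term is conformally invariant. With E the conformal factor, |A|^2 dA has density 2
    |f|^2 / E, from which f cancels. *)
Lemma weierstrass_map_jacobi_density f df X phi (z : C) : weierstrass_map f df X -> z <> 0%C ->
  f z <> 0%C ->
  jacobi_density X phi z
  = dx phi z ^ 2 + dy phi z ^ 2 - gauss_potential (fst z) (snd z) * phi z ^ 2.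
Proof.
  intros HX Hz Hf; destruct (weierstrass_map_metric f df X z HX Hz) as (E & F & G).
  destruct (weierstrass_map_h f df X z HX Hz Hf) as (A & B & C).
  pose proof (normsq_pos _ Hf) as Pf; pose proof (normsq_pos _ Hz) as Pz.
  assert (Hp : 0 < conformal_factor f z)
    by (unfold conformal_factor; apply Rmult_lt_0_compat; trivial; nra).
  unfold jacobi_density, norm_grad2, normA2.
  rewrite (metric_det_conformal X z _ E F G), sqrt_pow2, E, F, G, A, B, C by lra.
  assert (HV : gauss_potential (fst z) (snd z) = 2 * normsq (f z) / conformal_factor f z).
  { unfold gauss_potential, conformal_factor.
    replace (1 + fst z ^ 2 + snd z ^ 2) with (1 + normsq z) by (unfold normsq; ring).
    field; lra. }
  rewrite HV; clear HV; revert Hp; generalize (conformal_factor f z); intros c Hp.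
  unfold normsq; field; lra.
Qed.

(** * Branch points and stability *)

(** Monic polynomials of degree n in Horner form, kept as functions: counting roots needs only
    division by z - a. *)
Fixpoint monic (n : nat) (P : C -> C) : Prop :=
  match n with
  | 0%nat => forall z, P z = 1%C
  | S n' => exists Q b, monic n' Q /\ forall z, P z = (z * Q z + b)%C
  end.

Lemma monic_div_root n : forall P a, monic (S n) P ->
  exists Q, monic n Q /\ forall z, P z = ((z - a) * Q z + P a)%C.
Proof.
  induction n as [|n IH]; intros P a (Q & b & HQ & HP).
  - exists Q; split; trivial; intros z; rewrite !HP, !HQ; ring.
  - destruct (IH Q a HQ) as (Q' & HQ' & E).
    exists (fun z => z * Q' z + Q a)%C; split; [now exists Q', (Q a)|].
    intros z; rewrite !HP, (E z); ring.
Qed.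

Lemma monic_finite_roots n : forall P, monic n P -> finite_set (fun z => P z = 0%C).
Proof.
  induction n as [|n IH]; intros P HP.
  - exists nil; intros z Hz; simpl in HP; rewrite HP in Hz.
    apply (f_equal fst) in Hz; simpl in Hz; lra.
  - destruct (classic (exists a, P a = 0%C)) as [[a Ha]|Hn].
    + destruct (monic_div_root n P a HP) as (Q & HQ & E).
      destruct (IH Q HQ) as [l Hl]; exists (a :: l); intros z Hz.
      rewrite E, Ha, Cplus_0_r in Hz.
      destruct (classic (z = a)) as [->|Hza]; [now left|right; apply Hl].
      apply NNPP; intros HQz; apply (Cmult_neq_0 (z - a) (Q z)); trivial.
      intros Ez; apply Hza; replace z with (z - a + a)%C by ring; rewrite Ez; ring.
    + exists nil; intros z Hz; apply Hn; now exists z.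
Qed.

Lemma monic_pow n : monic n (fun z => z ^ n)%C.
Proof.
  induction n as [|n IH]; [intros z; reflexivity|].
  exists (fun z => z ^ n)%C, 0%C; split; trivial; intros z; rewrite Cpow_S; ring.
Qed.

Lemma finite_roots_of_unity n : finite_set (fun z : C => (z ^ S n = 1)%C).
Proof.
  destruct (monic_finite_roots (S n) (fun z => z ^ S n - 1)%C) as [l Hl].
  - exists (fun z => z ^ n)%C, (- (1))%C; split; [apply monic_pow|].
    intros z; rewrite Cpow_S; ring.
  - exists l; intros z Hz; apply Hl; rewrite Hz; ring.
Qed.

Lemma f_data_zero m (z : C) : z <> 0%C -> f_data m z = 0%C -> (z ^ S (2 * m + 1) = 1)%C.
Proof.
  intros Hz H; unfold f_data in H; replace (S (2 * m + 1)) with (2 * m + 2)%nat by lia.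
  apply NNPP; intros Hn; revert H; apply Cmult_neq_0; [apply Cmult_neq_0|].
  - apply Cpow_nz, Ci_nz.
  - pose proof (Cpow_nz z (m + 3) Hz) as Hp; intros E.
    apply (f_equal (fun w => w * z ^ (m + 3))%C) in E; rewrite Cinv_l in E by trivial.
    apply (f_equal fst) in E; simpl in E; lra.
  - intros E; apply Hn; replace (z ^ (2 * m + 2))%C with (z ^ (2 * m + 2) - 1 + 1)%C by ring.
    rewrite E; ring.
Qed.

Lemma finite_set_subset {T : Type} (A B : T -> Prop) :
  (forall x, A x -> B x) -> finite_set B -> finite_set A.
Proof. intros H [l Hl]; exists l; auto. Qed.

Lemma finite_f_data_zeros m : finite_set (fun z : C => z <> 0%C /\ f_data m z = 0%C).
Proof.
  apply finite_set_subset with (2 := finite_roots_of_unity (2 * m + 1)).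
  intros z [Hz H]; now apply f_data_zero.
Qed.

(** The interval is cut at each exceptional point in turn. This absorbs the default value of
    [jacobi_density] at branch points. *)
Lemma is_RInt_finite_change (f g : R -> R) (l : list R) :
  forall a b v, a <= b -> (forall x, a < x < b -> ~ In x l -> f x = g x) ->
  is_RInt f a b v -> is_RInt g a b v.
Proof.
  induction l as [|p l IH]; intros a b v Hab H Hf.
  - apply is_RInt_ext with f; trivial; rewrite Rmin_left, Rmax_right by trivial.
    intros x Hx; apply H; auto.
  - destruct (Rlt_dec a p) as [H1|H1]; [destruct (Rlt_dec p b) as [H2|H2]|].
    + assert (E1 : ex_RInt f a p) by (apply (ex_RInt_Chasles_1 (V := R_CompleteNormedModule)) with b; [lra|now exists v]).
      assert (E2 : ex_RInt f p b) by (apply (ex_RInt_Chasles_2 (V := R_CompleteNormedModule)) with a; [lra|now exists v]).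
      destruct E1 as [v1 E1]; destruct E2 as [v2 E2].
      assert (Ev : plus v1 v2 = v).
      { transitivity (RInt (V := R_CompleteNormedModule) f a b).
        - symmetry; apply (is_RInt_unique (V := R_CompleteNormedModule)).
          now apply (is_RInt_Chasles (V := R_NormedModule)) with p.
        - now apply (is_RInt_unique (V := R_CompleteNormedModule)). }
      rewrite <- Ev; apply (is_RInt_Chasles (V := R_NormedModule)) with p.
      * apply IH with (3 := E1); [lra|]; intros x Hx Hl; apply H; [lra|].
        intros [->|Hi]; [lra|auto].
      * apply IH with (3 := E2); [lra|]; intros x Hx Hl; apply H; [lra|].
        intros [->|Hi]; [lra|auto].
    + apply IH with (3 := Hf); trivial; intros x Hx Hl; apply H; trivial.
      intros [->|Hi]; [lra|auto].
    + apply IH with (3 := Hf); trivial; intros x Hx Hl; apply H; trivial.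
      intros [->|Hi]; [lra|auto].
Qed.

(** * Compact supports and test functions *)

Lemma open_of_cont2 (P : R -> R -> Prop) :
  (forall x y, P x y -> locally_2d P x y) ->
  open (T := C_UniformSpace) (fun z => P (fst z) (snd z)).
Proof.
  intros H z Hz; destruct z as [x y].
  now apply (locally_2d_locally P x y), H.
Qed.

Lemma locally_2d_pos f x y : cont2 f -> 0 < f x y -> locally_2d (fun u v => 0 < f u v) x y.
Proof.
  intros Hf Hp; destruct (Hf x y (mkposreal _ Hp)) as [d Hd]; exists d; intros u v Hu Hv.
  specialize (Hd u v Hu Hv); simpl in Hd; apply Rabs_def2 in Hd; lra.
Qed.

Lemma cont2_normsq : cont2 (fun x y => normsq (x, y)).
Proof. unfold normsq; simpl; change (cont2 (fun x y => x ^ 2 + y ^ 2)); auto with cont2. Qed.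

(** The open annuli 1/n < |z|^2 < n exhaust the punctured plane, so finitely many, hence the largest
    one, contain K. *)
Lemma compact_punctured_plane_bound (K : C -> Prop) :
  compact_for (open (T := C_UniformSpace)) K -> (forall z, K z -> punctured_plane z) ->
  exists N, 1 <= N /\ forall z, K z -> 1 < N * normsq z /\ normsq z < N.
Proof.
  intros HK HD.
  pose (U := fun n (z : C) => 0 < INR n * normsq (fst z, snd z) - 1 /\ 0 < INR n - normsq (fst z, snd z)).
  assert (HU : forall n, open (T := C_UniformSpace) (U n)).
  { intros n; apply (open_of_cont2 (fun x y => 0 < INR n * normsq (x, y) - 1 /\ 0 < INR n - normsq (x, y))).
    pose proof cont2_normsq as cn.
    intros x y [H1 H2]; apply locally_2d_and.
    - apply (locally_2d_pos (fun x y => INR n * normsq (x, y) - 1)); auto with cont2.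
    - apply (locally_2d_pos (fun x y => INR n - normsq (x, y))); auto with cont2. }
  destruct (HK (fun V => exists n, V = U n)) as (l & Hl & Hcov).
  - intros V [n ->]; apply HU.
  - intros z Hz; pose proof (normsq_pos z (HD z Hz)) as Hp.
    (* An n above |z|^2 + 1/|z|^2 satisfies both inequalities of the annulus at once. *)
    destruct (INR_unbounded (normsq z + / normsq z)) as [n Hn].
    pose proof (Rinv_0_lt_compat _ Hp).
    exists (U n); split; [now exists n|]; unfold U; rewrite <- surjective_pairing.
    split; [|lra].
    apply Rmult_gt_compat_r with (r := normsq z) in Hn; trivial.
    rewrite Rmult_plus_distr_r, Rinv_l in Hn by lra; nra.
  - assert (HN : exists N, 1 <= N /\ forall V, In V l -> exists n, V = U n /\ INR n <= N).
    { clear Hcov; induction l as [|V l IH].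
      - exists 1; split; [lra|]; intros V [].
      - destruct IH as (N & HN1 & HN); [intros W HW; apply Hl; now right|].
        destruct (Hl V (or_introl eq_refl)) as [n Hn].
        exists (Rmax N (INR n)); split; [apply Rle_trans with (1 := HN1), Rmax_l|].
        intros W [<-|HW]; [exists n; split; trivial; apply Rmax_r|].
        destruct (HN W HW) as (k & Hk1 & Hk2); exists k; split; trivial.
        apply Rle_trans with (1 := Hk2), Rmax_l. }
    destruct HN as (N & HN1 & HN); exists N; split; trivial; intros z Hz.
    destruct (Hcov z Hz) as (V & HV & Hz'); destruct (HN V HV) as (n & -> & Hn).
    destruct Hz' as [H1 H2]; rewrite <- surjective_pairing in H1, H2.
    pose proof (normsq_pos z (HD z Hz)); nra.
Qed.

Lemma locally_zero_derivatives phi (z : C) :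
  locally_2d (fun x y => phi (x, y) = 0) (fst z) (snd z) -> phi z = 0 /\ dx phi z = 0 /\ dy phi z = 0.
Proof.
  intros H; split; [|split].
  - rewrite (surjective_pairing z); exact (locally_2d_singleton _ _ _ H).
  - unfold dx; rewrite (Derive_ext_loc _ (fun _ => 0)); [apply Derive_const|].
    exact (locally_2d_1d_const_y _ _ _ H).
  - unfold dy; rewrite (Derive_ext_loc _ (fun _ => 0)); [apply Derive_const|].
    exact (locally_2d_1d_const_x _ _ _ H).
Qed.

Lemma antipodal_coord (x y : R) : (x, y) <> 0%C :> C ->
  antipodal (x, y) = (- x / (x ^ 2 + y ^ 2), - y / (x ^ 2 + y ^ 2)).
Proof.
  intros Hz; pose proof (normsq_pos _ Hz) as Hp; unfold normsq in Hp; simpl in Hp.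
  unfold antipodal; apply injective_projections; simpl; field; nra.
Qed.

(** Smoothness is assumed only away from 0, but the support stays away from 0, so phi vanishes near
    0 and is C^1 on the whole plane. *)
Lemma test_function_C1_supported phi : test_function punctured_plane phi ->
  exists M, 0 < M /\
    C1_supported M (fun x y => phi (x, y)) (fun x y => dx phi (x, y)) (fun x y => dy phi (x, y)) /\
    (forall x y, M < Rabs x \/ M < Rabs y -> phi (x, y) = 0 /\ dx phi (x, y) = 0 /\ dy phi (x, y) = 0) /\
    phi 0%C = 0 /\ dx phi 0%C = 0 /\ dy phi 0%C = 0.
Proof.
  intros [Hreg (K & HK & HKD & Hphi)].
  destruct (compact_punctured_plane_bound K HK HKD) as (N & HN & HNK).
  assert (Hbig : forall x y, N <= Rabs x \/ N <= Rabs y -> N <= normsq (x, y)).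
  { intros x y H; unfold normsq; simpl.
    pose proof (pow2_abs x) as E1; pose proof (pow2_abs y) as E2; simpl in E1, E2.
    pose proof (Rabs_pos x); pose proof (Rabs_pos y); destruct H; nra. }
  assert (Hout : forall x y, N <= normsq (x, y) -> phi (x, y) = 0).
  { intros x y H; apply Hphi; intros Hk; destruct (HNK _ Hk); lra. }
  assert (Hin : forall x y, N * normsq (x, y) <= 1 -> phi (x, y) = 0).
  { intros x y H; apply Hphi; intros Hk; destruct (HNK _ Hk); lra. }
  pose proof cont2_normsq as cn.
  assert (L0 : locally_2d (fun x y => phi (x, y) = 0) 0 0).
  { generalize (locally_2d_pos (fun x y => 1 - N * normsq (x, y)) 0 0
      ltac:(auto with cont2) ltac:(unfold normsq; simpl; lra)).
    apply locally_2d_impl, locally_2d_forall; intros x y H; apply Hin; lra. }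
  assert (Lz : locally_2d (fun x y => dx phi (x, y) = 0 /\ dy phi (x, y) = 0) 0 0).
  { revert L0; apply locally_2d_impl_strong, locally_2d_forall; intros x y H.
    now apply (locally_zero_derivatives phi (x, y)). }
  assert (Hreg2 : forall x y, continuity_2d_pt (fun x y => phi (x, y)) x y /\
    ex_derive (fun t => phi (t, y)) x /\ ex_derive (fun t => phi (x, t)) y /\
    continuity_2d_pt (fun x y => dx phi (x, y)) x y /\
    continuity_2d_pt (fun x y => dy phi (x, y)) x y).
  { intros x y; destruct (classic ((x, y) = 0%C :> C)) as [E|Hn].
    - injection E as -> ->; repeat split.
      + apply continuity_2d_pt_ext_loc with (fun _ _ => 0); [|apply continuity_2d_pt_const].
        revert L0; apply locally_2d_impl, locally_2d_forall; now intros.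
      + apply ex_derive_ext_loc with (fun _ => 0); [|apply ex_derive_const].
        generalize (locally_2d_1d_const_y _ _ _ L0); apply filter_imp; now intros.
      + apply ex_derive_ext_loc with (fun _ => 0); [|apply ex_derive_const].
        generalize (locally_2d_1d_const_x _ _ _ L0); apply filter_imp; now intros.
      + apply continuity_2d_pt_ext_loc with (fun _ _ => 0); [|apply continuity_2d_pt_const].
        revert Lz; apply locally_2d_impl, locally_2d_forall; intros u v [H1 H2]; now symmetry.
      + apply continuity_2d_pt_ext_loc with (fun _ _ => 0); [|apply continuity_2d_pt_const].
        revert Lz; apply locally_2d_impl, locally_2d_forall; intros u v [H1 H2]; now symmetry.
    - destruct (Hreg (x, y) 1%nat Hn) as (H1 & H2 & H3 & (H4 & _) & (H5 & _)).
      repeat split; assumption. }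
  exists N; split; [lra|split; [|split]].
  - split; [|split; [|split]].
    + repeat split; intros x y; apply Hreg2.
    + intros x y; destruct (Hreg2 x y) as (_ & H & _); exact (Derive_correct _ _ H).
    + intros x y; destruct (Hreg2 x y) as (_ & _ & H & _); exact (Derive_correct _ _ H).
    + intros x y H; apply Hout, Hbig, H.
  - intros x y H; apply (locally_zero_derivatives phi (x, y)); simpl.
    assert (Hl : 0 < normsq (x, y) - N).
    { unfold normsq; simpl.
      pose proof (pow2_abs x) as E1; pose proof (pow2_abs y) as E2; simpl in E1, E2.
      pose proof (Rabs_pos x); pose proof (Rabs_pos y); destruct H; nra. }
    generalize (locally_2d_pos (fun x y => normsq (x, y) - N) x y ltac:(auto with cont2) Hl).
    apply locally_2d_impl, locally_2d_forall; intros u v Hu; apply Hout; lra.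
  - now apply (locally_zero_derivatives phi 0%C).
Qed.

Lemma weierstrass_map_stable m X phi : weierstrass_map (f_data m) (df_laurent m) X ->
  test_function punctured_plane phi ->
  (forall z, punctured_plane z -> phi (antipodal z) = - phi z) ->
  exists v, is_plane_integral (jacobi_density X phi) v /\ 0 <= v.
Proof.
  intros HX Hphi Hodd.
  destruct (test_function_C1_supported phi Hphi) as (M & HM & HC & Hout & E0 & E1 & E2).
  destruct (finite_f_data_zeros m) as [l Hl].
  (* The continuous extension of the density across 0 and the branch points. *)
  set (q := fun x y => dx phi (x, y) ^ 2 + dy phi (x, y) ^ 2 - gauss_potential x y * phi (x, y) ^ 2).
  exists (stability_form M (fun x y => phi (x, y)) (fun x y => dx phi (x, y)) (fun x y => dy phi (x, y))).
  assert (cq : cont2 q).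
  { destruct HC as ((c0 & c1 & c2) & _); pose proof cont2_gauss_potential; unfold q.
    auto with cont2. }
  assert (Hq : forall x y, ~ In (x, y) l -> q x y = jacobi_density X phi (x, y)).
  { intros x y Hn; destruct (classic ((x, y) = 0%C :> C)) as [E|Hz].
    (* X is unconstrained at 0; the density is still 0 there because phi and its partial derivatives
       are. *)
    - injection E as -> ->; unfold q, jacobi_density, norm_grad2.
      change (0, 0) with (RtoC 0); rewrite E0, E1, E2; unfold Rdiv; ring.
    - symmetry; apply (weierstrass_map_jacobi_density _ _ _ phi (x, y) HX Hz).
      intros Hf; apply Hn, Hl; now split. }
  assert (Hslice : forall y, is_RInt (fun x => jacobi_density X phi (x, y)) (- M) M
                    (RInt (fun x => q x y) (- M) M)).
  { intros y; apply is_RInt_finite_change with (fun x => q x y) (map fst l); [lra| |].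
    - intros x _ Hx; apply Hq; intros Hi; apply Hx.
      now apply (in_map fst) in Hi.
    - apply (RInt_correct (V := R_CompleteNormedModule)); now apply cont2_ex_RInt. }
  split.
  - exists M; split; [trivial|split; [|split]].
    + intros x y H; destruct (Hout x y H) as (H0 & H1 & H2).
      unfold jacobi_density, norm_grad2; rewrite H0, H1, H2; unfold Rdiv; ring.
    + intros y; eexists; apply Hslice.
    + apply is_RInt_ext with (fun y => RInt (fun x => q x y) (- M) M).
      * intros y _; symmetry; apply (is_RInt_unique (V := R_CompleteNormedModule)), Hslice.
      * apply (RInt_correct (V := R_CompleteNormedModule)); now apply ex_square_integral.
  - apply stability_form_nonneg; trivial; intros x y H.
    assert (Hz : (x, y) <> 0%C :> C) by (intros E; injection E as -> ->; simpl in H; lra).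
    rewrite <- (Hodd (x, y) Hz), antipodal_coord, H by trivial; f_equal.
    apply injective_projections; simpl; field.
Qed.

(** * Completeness and the quotient *)

(** S is the sum 1 + s + ... + s^n, which dominates its first and its last term. *)
Lemma geometric_factor (s : R) n : 0 < s ->
  exists S, s ^ (n + 1) - 1 = (s - 1) * S /\ 1 <= S /\ s ^ n <= S.
Proof.
  intros Hs; induction n as [|n (S & H1 & H2 & H3)].
  - exists 1; simpl; lra.
  - exists (s ^ (n + 1) + S); pose proof (pow_lt s (n + 1) Hs).
    replace (Datatypes.S n) with (n + 1)%nat by lia; split; [|lra].
    rewrite (pow_add s (n + 1) 1), pow_1; lra.
Qed.

(** The reverse triangle inequality, squared, with s = |w|. *)
Lemma normsq_minus_one (w : C) s : 0 <= s -> normsq w = s ^ 2 -> (s - 1) ^ 2 <= normsq (w - 1)%C.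
Proof.
  unfold normsq; destruct w as [x y]; simpl; intros Hs H.
  assert (x <= s) by (apply Rnot_lt_le; intros Hx; nra); nra.
Qed.

Lemma normsq_Ci_pow n : normsq (Ci ^ n)%C = 1.
Proof.
  rewrite normsq_pow; replace (normsq Ci) with 1 by (unfold normsq; simpl; ring); apply pow1.
Qed.

(** With s = |z|^2, |z^(2m+2) - 1| >= |s^(m+1) - 1| = |s - 1| S, and S^2 >= s^m compensates the
    growth in m of the denominator s^(m+3). The bound is independent of m. *)
Lemma conformal_factor_lower_bound m (z : C) : z <> 0%C ->
  / 4 * (normsq z ^ 2 - 1) ^ 2 / normsq z ^ 3 <= conformal_factor (f_data m) z.
Proof.
  intros Hz; pose proof (normsq_pos z Hz) as Hp; set (s := normsq z) in *.
  assert (Hf : (s - 1) ^ 2 / s ^ 3 <= normsq (f_data m z)).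
  { unfold f_data; rewrite !normsq_mult, normsq_Ci_pow, normsq_inv, normsq_pow by now apply Cpow_nz.
    fold s; rewrite Rmult_1_l, pow_add.
    destruct (geometric_factor s m Hp) as (S & H1 & H2 & H3).
    pose proof (pow_lt s m Hp) as Hm; pose proof (pow_lt s 3 Hp) as H3'.
    assert (Hw : (s ^ (m + 1) - 1) ^ 2 <= normsq (z ^ (2 * m + 2) - 1)%C).
    { apply normsq_minus_one; [apply pow_le; lra|].
      rewrite normsq_pow; fold s; rewrite <- pow_mult; f_equal; lia. }
    rewrite H1 in Hw.
    assert (Hk : (s - 1) ^ 2 * s ^ m <= normsq (z ^ (2 * m + 2) - 1)%C).
    { apply Rle_trans with (2 := Hw); rewrite Rpow_mult_distr.
      apply Rmult_le_compat_l; [apply pow2_ge_0|nra]. }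
    apply Rmult_le_reg_l with (s ^ m * s ^ 3); [nra|].
    replace (s ^ m * s ^ 3 * ((s - 1) ^ 2 / s ^ 3)) with ((s - 1) ^ 2 * s ^ m) by (field; lra).
    replace (s ^ m * s ^ 3 * (/ (s ^ m * s ^ 3) * normsq (z ^ (2 * m + 2) - 1)%C))
      with (normsq (z ^ (2 * m + 2) - 1)%C) by (field; lra).
    exact Hk. }
  unfold conformal_factor; fold s.
  replace (/ 4 * (s ^ 2 - 1) ^ 2 / s ^ 3) with (/ 4 * (1 + s) ^ 2 * ((s - 1) ^ 2 / s ^ 3))
    by (field; lra).
  apply Rmult_le_compat_l; trivial; pose proof (pow2_ge_0 (1 + s)); lra.
Qed.

(* Proper on the quotient: it tends to infinity at both ends of the punctured plane. *)
Definition exhaustion (z : C) : R := normsq z + / normsq z.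

Lemma normsq_antipodal (z : C) : z <> 0%C -> normsq (antipodal z) = / normsq z.
Proof.
  intros Hz; pose proof (normsq_pos z Hz) as Hp; destruct z as [x y].
  rewrite antipodal_coord by trivial; unfold normsq in *; simpl in *; field; lra.
Qed.

Lemma exhaustion_antipodal (z : C) : z <> 0%C -> exhaustion (antipodal z) = exhaustion z.
Proof.
  intros Hz; unfold exhaustion; rewrite normsq_antipodal, Rinv_inv by trivial; ring.
Qed.

Lemma continuous_Rmult (f g : R -> R) t :
  continuous f t -> continuous g t -> continuous (fun s => f s * g s) t.
Proof. apply (continuous_mult (K := R_AbsRing)). Qed.

Lemma continuous_Rplus (f g : R -> R) t :
  continuous f t -> continuous g t -> continuous (fun s => f s + g s) t.
Proof. apply (continuous_plus (V := R_NormedModule)). Qed.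

Lemma continuous_sqr (f : R -> R) t : continuous f t -> continuous (fun s => f s ^ 2) t.
Proof.
  intros H; apply continuous_ext with (fun s => f s * f s); [intros s; change (f s * f s = f s ^ 2); ring|].
  now apply continuous_Rmult.
Qed.

Lemma continuous_normsq (c : R -> C) t :
  continuous (fun s => fst (c s)) t -> continuous (fun s => snd (c s)) t ->
  continuous (fun s => normsq (c s)) t.
Proof. intros H1 H2; apply continuous_Rplus; now apply continuous_sqr. Qed.

Lemma is_curve_derive_continuous c t v : is_curve_derive c t v ->
  continuous (fun s => fst (c s)) t /\ continuous (fun s => snd (c s)) t.
Proof. intros [H1 H2]; split; eapply continuous_of_is_derive; eassumption. Qed.

(** The left side is a quarter of the differential of s + 1/s on v. By Cauchy-Schwarz its square is
    at most (1/4) (s^2 - 1)^2 / s^3 |v|^2, exactly the lower bound of the metric: this fixes the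
    constant 1/4. *)
Lemma exhaustion_derivative_bound m (z v : C) : z <> 0%C ->
  / 4 * ((1 - / normsq z ^ 2) * (2 * (fst z * fst v + snd z * snd v)))
  <= sqrt (conformal_factor (f_data m) z * normsq v).
Proof.
  intros Hz; pose proof (normsq_pos z Hz) as Hp; set (s := normsq z) in *.
  apply Rle_trans with (1 := Rle_abs _); rewrite <- sqrt_Rsqr_abs; apply sqrt_le_1_alt.
  assert (Hv : 0 <= normsq v) by (unfold normsq; nra).
  apply Rle_trans with (/ 4 * (s ^ 2 - 1) ^ 2 / s ^ 3 * normsq v);
    [|apply Rmult_le_compat_r; [trivial|now apply conformal_factor_lower_bound]].
  assert (Hcs : (fst z * fst v + snd z * snd v) ^ 2 <= s * normsq v).
  { unfold s, normsq; pose proof (pow2_ge_0 (fst z * snd v - snd z * fst v)); lra. }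
  unfold Rsqr.
  replace (_ * _) with (/ 4 * (s ^ 2 - 1) ^ 2 / s ^ 4 * (fst z * fst v + snd z * snd v) ^ 2)
    by (field; lra).
  replace (/ 4 * (s ^ 2 - 1) ^ 2 / s ^ 3 * normsq v)
    with (/ 4 * (s ^ 2 - 1) ^ 2 / s ^ 4 * (s * normsq v)) by (field; lra).
  apply Rmult_le_compat_l; trivial.
  pose proof (pow2_ge_0 (s ^ 2 - 1)); pose proof (pow_lt s 4 Hp).
  apply Rdiv_le_0_compat; lra.
Qed.

Lemma is_derive_exhaustion (x y : R -> R) t x' y' :
  is_derive x t x' -> is_derive y t y' -> 0 < x t ^ 2 + y t ^ 2 ->
  is_derive (fun s => / 4 * ((x s ^ 2 + y s ^ 2) + / (x s ^ 2 + y s ^ 2))) t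
    (/ 4 * ((1 - / (x t ^ 2 + y t ^ 2) ^ 2) * (2 * (x t * x' + y t * y')))).
Proof.
  intros Hx Hy Hp; auto_derive.
  - repeat split; try (eexists; eassumption); simpl in *; lra.
  - change (Derive (fun s => x s) t) with (Derive x t).
    change (Derive (fun s => y s) t) with (Derive y t).
    rewrite (is_derive_unique _ _ _ Hx), (is_derive_unique _ _ _ Hy).
    field; simpl in *; lra.
Qed.

Lemma arc_length_lower_bound m X c a b : (1 <= m)%nat ->
  weierstrass_map (f_data m) (df_laurent m) X -> a < b -> C1_curve c ->
  (forall t, a <= t <= b -> c t <> 0%C) ->
  / 4 * (exhaustion (c b) - exhaustion (c a)) <= RInt (fun t => ds X (c t) (velocity c t)) a b.
Proof.
  intros Hm HX Hab Hc HD.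
  assert (Hcont : forall t, continuous (fun s => normsq (c s)) t /\
    continuous (fun s => normsq (velocity c s)) t /\
    continuous (fun s => fst (c s) * fst (velocity c s) + snd (c s) * snd (velocity c s)) t).
  { intros t; destruct (Hc t) as (_ & _ & V1 & V2).
    destruct (is_curve_derive_continuous _ _ _ (C1_curve_derive c t Hc)) as [C1 C2].
    split; [|split].
    - exact (continuous_normsq c t C1 C2).
    - exact (continuous_normsq (velocity c) t V1 V2).
    - exact (continuous_Rplus _ _ t (continuous_Rmult _ _ t C1 V1) (continuous_Rmult _ _ t C2 V2)). }
  pose (g' := fun t => / 4 * ((1 - / normsq (c t) ^ 2)
    * (2 * (fst (c t) * fst (velocity c t) + snd (c t) * snd (velocity c t))))).
  pose (L := fun t => sqrt (conformal_factor (f_data m) (c t) * normsq (velocity c t))).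
  assert (Hg' : forall t, a <= t <= b -> continuous g' t).
  { intros t Ht; pose proof (normsq_pos _ (HD t Ht)) as Hp; destruct (Hcont t) as (N1 & _ & N2).
    apply continuous_Rmult; [apply continuous_const|apply continuous_Rmult].
    - apply (continuous_minus (V := R_NormedModule)); [apply continuous_const|].
      apply (continuous_comp (fun s => normsq (c s) ^ 2) Rinv).
      + exact (continuous_sqr _ t N1).
      + apply continuous_Rinv, pow_nonzero; lra.
    - apply continuous_Rmult; [apply continuous_const|exact N2]. }
  assert (HL : forall t, a <= t <= b -> continuous L t).
  { intros t Ht; destruct (Hcont t) as (N1 & N2 & _).
    apply (continuous_comp (fun s => conformal_factor (f_data m) (c s) * normsq (velocity c s)) sqrt).
    - apply continuous_Rmult; [|exact N2].
      assert (Hf : continuous (fun s => normsq (f_data m (c s))) t).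
      { pose proof (curve_hol_f_data m (c t) Hm (HD t Ht) c t _ eq_refl
          (C1_curve_derive c t Hc)) as H.
        destruct (is_curve_derive_continuous _ _ _ H) as [F1 F2].
        exact (continuous_normsq _ t F1 F2). }
      unfold conformal_factor; apply continuous_Rmult; [|exact Hf].
      apply continuous_Rmult; [apply continuous_const|].
      apply continuous_sqr, continuous_Rplus; [apply continuous_const|exact N1].
    - apply continuity_pt_filterlim, continuity_pt_sqrt.
      unfold conformal_factor, normsq; nra. }
  rewrite (RInt_ext _ L).
  - replace (/ 4 * (exhaustion (c b) - exhaustion (c a))) with (RInt g' a b).
    + apply RInt_le; [lra| | |].
      * apply (ex_RInt_continuous (V := R_CompleteNormedModule)).
        rewrite Rmin_left, Rmax_right by lra; exact Hg'.
      * apply (ex_RInt_continuous (V := R_CompleteNormedModule)).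
        rewrite Rmin_left, Rmax_right by lra; exact HL.
      * intros t Ht; apply exhaustion_derivative_bound, HD; lra.
    + apply is_RInt_unique.
      replace (/ 4 * (exhaustion (c b) - exhaustion (c a)))
        with (minus (/ 4 * exhaustion (c b)) (/ 4 * exhaustion (c a)))
        by (unfold minus, plus, opp; simpl; ring).
      apply (is_RInt_derive (V := R_CompleteNormedModule) (fun t => / 4 * exhaustion (c t)));
        rewrite Rmin_left, Rmax_right by lra; [|exact Hg'].
      intros t Ht; pose proof (normsq_pos _ (HD t Ht)) as Hp.
      destruct (C1_curve_derive c t Hc) as [D1 D2].
      exact (is_derive_exhaustion _ _ t _ _ D1 D2 Hp).
  - rewrite Rmin_left, Rmax_right by lra; intros t Ht.
    destruct (weierstrass_map_metric _ _ X (c t) HX (HD t ltac:(lra))) as (E & F & G).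
    unfold ds, L; rewrite E, F, G; f_equal; unfold normsq; ring.
Qed.

(** * Compact sublevel sets in the quotient, and completeness *)

Definition sublevel (B : R) (z : C) : Prop := normsq z ^ 2 + 1 <= B * normsq z.

(** The bound on [exhaustion] is multiplied out by |z|^2: at 0 it reads 1 <= 0, whereas the total
    inverse would make [exhaustion] vanish there. *)
Lemma sublevel_nonzero B z : sublevel B z -> z <> 0%C.
Proof. intros H ->; unfold sublevel, normsq in H; simpl in H; lra. Qed.

Lemma exhaustion_not_sublevel B (z : C) : z <> 0%C -> ~ sublevel B z -> B < exhaustion z.
Proof.
  intros Hz H; unfold sublevel in H; apply Rnot_le_lt in H; pose proof (normsq_pos z Hz) as Hp.
  unfold exhaustion; apply Rmult_lt_reg_r with (normsq z); trivial.
  rewrite Rmult_plus_distr_r, Rinv_l by lra; lra.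
Qed.

Definition box (z0 : C) (d : R) (z : C) : Prop :=
  Rabs (fst z - fst z0) < d /\ Rabs (snd z - snd z0) < d.

Lemma box_compact (M : R) (delta : C -> posreal) :
  exists l : list C, forall z : C, Rabs (fst z) <= M -> Rabs (snd z) <= M ->
    exists t, In t l /\ box t (delta t) z.
Proof.
  apply NNPP; intros Hn.
  (* Plane points are nested pairs ending in [tt] here, and the finite list is only given under a
     double negation. *)
  apply (compactness_list 2 (- M, (- M, tt)) (M, (M, tt))
    (fun t => delta (fst t, fst (snd t)))); intros [l Hl]; apply Hn.
  exists (map (fun t : R * (R * unit) => (fst t, fst (snd t))) l); intros [x y] Hx Hy; simpl in Hx, Hy.
  apply Rabs_le_between in Hx; apply Rabs_le_between in Hy.
  destruct (Hl (x, (y, tt))) as ((a & b & u) & Hi & _ & Hc); [now repeat split|].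
  exists (a, b); split; [exact (in_map _ _ _ Hi)|].
  simpl in Hc; destruct Hc as (H1 & H2 & _); now split.
Qed.

Definition quot_sublevel (B : R) (q : quot punctured_plane antipodal) : Prop :=
  exists (z : C) (Hz : punctured_plane z), q = proj punctured_plane antipodal z Hz /\ sublevel B z.

(** Heine-Borel is applied upstairs: around each point some box either projects into one member of
    the cover or misses the closed sublevel set. *)
Lemma quot_sublevel_compact B :
  compact_for (quot_open punctured_plane antipodal) (quot_sublevel B).
Proof.
  intros cover Hopen Hcov.
  pose (good := fun (U : quot punctured_plane antipodal -> Prop) (z0 : C) (d : R) =>
    cover U /\ forall z, box z0 d z -> exists Hz, U (proj punctured_plane antipodal z Hz)).
  assert (Hloc : forall z0, exists d : posreal,
    (exists U, good U z0 d) \/ forall z, box z0 d z -> ~ sublevel B z).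
  { intros z0; destruct (classic (sublevel B z0)) as [Hs|Hs].
    - pose (Hz0 := sublevel_nonzero B z0 Hs : punctured_plane z0).
      destruct (Hcov (proj _ _ z0 Hz0)) as (U & HU & HUz); [now exists z0, Hz0|].
      destruct (Hopen U HU z0 (ex_intro _ Hz0 HUz)) as [d Hd].
      exists d; left; exists U; split; trivial; intros z [H1 H2]; apply Hd; now split.
    - unfold sublevel in Hs; apply Rnot_le_lt in Hs.
      assert (Hc : cont2 (fun x y => normsq (x, y) ^ 2 + 1 - B * normsq (x, y)))
        by (pose proof cont2_normsq; auto with cont2).
      assert (Hp : 0 < normsq (fst z0, snd z0) ^ 2 + 1 - B * normsq (fst z0, snd z0))
        by (rewrite <- surjective_pairing; lra).
      destruct (locally_2d_pos _ _ _ Hc Hp) as [d Hd].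
      exists d; right; intros z [H1 H2] Hz; specialize (Hd _ _ H1 H2).
      rewrite <- surjective_pairing in Hd; unfold sublevel in Hz; lra. }
  pose (delta := fun z0 => proj1_sig (constructive_indefinite_description _ (Hloc z0))).
  assert (Hdelta : forall z0, (exists U, good U z0 (delta z0)) \/
      forall z, box z0 (delta z0) z -> ~ sublevel B z)
    by (intros z0; exact (proj2_sig (constructive_indefinite_description _ (Hloc z0)))).
  (* On the sublevel set |z|^2 <= B, so both coordinates are at most |B| + 1 in absolute value. *)
  destruct (box_compact (Rabs B + 1) delta) as [l Hl].
  assert (HlU : exists lU, (forall U, In U lU -> cover U) /\
    forall t z, In t l -> box t (delta t) z -> sublevel B z ->
      exists U, In U lU /\ exists Hz, U (proj punctured_plane antipodal z Hz)).
  { clear Hl; induction l as [|t l (lU & H1 & H2)].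
    - exists nil; split; [intros U []|intros t z []].
    - destruct (Hdelta t) as [[U [HU HUt]]|Ht].
      + exists (U :: lU); split; [intros V [<-|HV]; auto|].
        intros t' z [<-|Hi] Hb Hs; [exists U; split; [now left|auto]|].
        destruct (H2 t' z Hi Hb Hs) as (V & HV & Hz); exists V; split; [now right|trivial].
      + exists lU; split; trivial; intros t' z [<-|Hi] Hb Hs; [now elim (Ht z Hb)|].
        now apply (H2 t' z). }
  destruct HlU as (lU & H1 & H2); exists lU; split; trivial.
  intros q (z & Hz & -> & Hs).
  assert (Hn : normsq z <= B).
  { unfold sublevel in Hs; pose proof (normsq_pos z Hz); nra. }
  assert (Hbox : forall x, x ^ 2 <= normsq z -> Rabs x <= Rabs B + 1).
  { intros x Hx; rewrite <- pow2_abs in Hx; pose proof (Rabs_pos x); pose proof (Rle_abs B); nra. }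
  destruct (Hl z) as (t & Hi & Hb).
  - apply Hbox; unfold normsq; nra.
  - apply Hbox; unfold normsq; nra.
  - destruct (H2 t z Hi Hb Hs) as (U & HU & Hz' & HUz); exists U; split; trivial.
    now rewrite (proof_irrelevance _ Hz Hz').
Qed.

Lemma proj_eq z w Hz Hw :
  proj punctured_plane antipodal z Hz = proj punctured_plane antipodal w Hw ->
  z = w \/ z = antipodal w.
Proof.
  intros H; apply (f_equal (@proj1_sig _ _)) in H; simpl in H.
  assert (E : orbit antipodal w z) by (rewrite <- H; now left); exact E.
Qed.

Lemma exhaustion_proj z w Hz Hw :
  proj punctured_plane antipodal z Hz = proj punctured_plane antipodal w Hw ->
  exhaustion z = exhaustion w.
Proof.
  intros H; destruct (proj_eq z w Hz Hw H) as [-> | ->]; trivial; now apply exhaustion_antipodal.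
Qed.

(** The length of each arc dominates a quarter of the increase of [exhaustion]; these increases
    telescope, and a divergent curve leaves every compact sublevel set. *)
Lemma weierstrass_map_complete m X q tau c : (1 <= m)%nat ->
  weierstrass_map (f_data m) (df_laurent m) X ->
  piecewise_C1 punctured_plane antipodal q tau c -> divergent punctured_plane antipodal q ->
  is_lim_seq (sum_n (fun k => RInt (fun t => ds X (c k t) (velocity (c k) t)) (tau k) (tau (S k))))
    p_infty.
Proof.
  intros Hm HX (Ht0 & Htau & Hlim & Hc) Hdiv.
  pose (h := fun k => exhaustion (c k (tau k))).
  pose (len := fun k => RInt (fun t => ds X (c k t) (velocity (c k) t)) (tau k) (tau (S k))).
  assert (Hlen : forall k, / 4 * (h (S k) - h k) <= len k).
  { intros k; destruct (Hc k) as [C1 Hk]; destruct (Hc (S k)) as [_ HSk].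
    (* Consecutive lifts may differ by the antipodal map at a break point; the invariance of
       [exhaustion] keeps the sum telescoping. *)
    assert (E : h (S k) = exhaustion (c k (tau (S k)))).
    { destruct (Hk (tau (S k))) as [Hz Ez]; [pose proof (Htau k); lra|].
      destruct (HSk (tau (S k))) as [Hw Ew]; [pose proof (Htau (S k)); lra|].
      rewrite Ez in Ew; symmetry; apply (exhaustion_proj _ _ _ _ Ew). }
    rewrite E; apply (arc_length_lower_bound m X (c k)); [exact Hm|exact HX|apply Htau|exact C1|].
    intros t Ht; destruct (Hk t Ht) as [Hz _]; exact Hz. }
  assert (Hsum : forall n, / 4 * (h (S n) - h 0%nat) <= sum_n len n).
  { induction n as [|n IH]; [rewrite sum_O; apply Hlen|].
    rewrite sum_Sn; unfold plus; simpl; specialize (Hlen (S n)); lra. }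
  apply is_lim_seq_spec; intros M.
  (* Leaving this sublevel set makes a quarter of the increase since time 0 exceed M. *)
  destruct (Hdiv (quot_sublevel (4 * M + h 0%nat)) (quot_sublevel_compact _)) as [T HT].
  apply is_lim_seq_spec in Hlim; destruct (Hlim T) as [N HN].
  exists N; intros n Hn; apply Rlt_le_trans with (2 := Hsum n).
  assert (HTn : T <= tau (S n)) by (apply Rlt_le, HN; lia).
  destruct (Hc (S n)) as [_ HSn].
  destruct (HSn (tau (S n))) as [Hz Ez]; [pose proof (Htau (S n)); lra|].
  assert (Hb : 4 * M + h 0%nat < h (S n)).
  { apply exhaustion_not_sublevel; [exact Hz|]; intros Hs.
    apply (HT _ HTn); rewrite Ez; now exists (c (S n) (tau (S n))), Hz. }
  lra.
Qed.

(** * The involution and non-orientability of the quotient *)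

Lemma antipodal_neq0 (z : C) : z <> 0%C -> antipodal z <> 0%C.
Proof.
  intros Hz E; pose proof (normsq_antipodal z Hz) as H; rewrite E in H.
  pose proof (Rinv_0_lt_compat _ (normsq_pos z Hz)).
  unfold normsq in H at 1; simpl in H; lra.
Qed.

Lemma antipodal_involutive (z : C) : z <> 0%C -> antipodal (antipodal z) = z.
Proof.
  intros Hz; pose proof (normsq_pos z Hz) as Hp; destruct z as [x y].
  rewrite (antipodal_coord x y Hz), antipodal_coord.
  - unfold normsq in Hp; simpl in Hp.
    apply injective_projections; simpl; field; repeat split; simpl in *; nra.
  - rewrite <- (antipodal_coord x y Hz); now apply antipodal_neq0.
Qed.

(** The image of z is - i z with i = 1/|z|^2 > 0, a negative multiple of z. *)
Lemma antipodal_free (z : C) : z <> 0%C -> antipodal z <> z.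
Proof.
  intros Hz E; pose proof (normsq_pos z Hz) as Hp; destruct z as [x y].
  rewrite (antipodal_coord x y Hz) in E; injection E as E1 E2; unfold normsq in Hp.
  cbn [fst snd] in Hp; pose proof (Rinv_0_lt_compat _ Hp) as Hi; unfold Rdiv in *.
  change (x * (x * 1) + y * (y * 1)) with (x ^ 2 + y ^ 2) in E1, E2.
  revert Hi E1 E2; generalize (/ (x ^ 2 + y ^ 2)); intros i Hi E1 E2.
  assert (Hx : x * (1 + i) = 0) by lra; assert (Hy : y * (1 + i) = 0) by lra.
  apply Rmult_integral in Hx; apply Rmult_integral in Hy.
  destruct Hx as [-> | Hx]; [destruct Hy as [-> | Hy]|]; lra.
Qed.

Lemma is_C_derive_inv (z : C) : z <> 0%C ->
  is_derive (K := C_AbsRing) (V := C_NormedModule) (fun w => / w)%C z (- (/ z * / z))%C.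
Proof.
  intros Hz; split; [apply is_linear_scal_l|].
  intros x Hx; apply (is_filter_lim_locally_unique (V := AbsRing_NormedModule C_AbsRing)) in Hx; subst x.
  intros eps; pose proof (Cmod_gt_0 z) as [Hc _]; specialize (Hc Hz).
  (* The remainder is (w - z)^2 / (w z^2). The first entry gives |w| > |z|/2, the second then makes
     the remainder at most eps |w - z|. *)
  set (r := Rmin (Cmod z / 2) (eps * Cmod z ^ 3 / 2)).
  assert (He : 0 < eps * Cmod z ^ 3 / 2)
    by (pose proof (cond_pos eps); pose proof (pow_lt _ 3 Hc); nra).
  assert (Hr : 0 < r) by (apply Rmin_pos; lra).
  enough (H : forall w : C, Cmod (w - z)%C < r ->
    Cmod (/ w - / z - (w - z) * - (/ z * / z))%C <= eps * Cmod (w - z)%C)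
    by (exists (mkposreal r Hr); exact H).
  intros w Hw.
  assert (Hr1 : r <= Cmod z / 2) by apply Rmin_l.
  assert (Hr2 : r <= eps * Cmod z ^ 3 / 2) by apply Rmin_r.
  assert (Hwm : Cmod z / 2 < Cmod w).
  { pose proof (Cmod_triangle (z - w)%C w) as Ht.
    replace (z - w + w)%C with z in Ht by ring.
    replace (z - w)%C with (- (w - z))%C in Ht by ring; rewrite Cmod_opp in Ht; lra. }
  assert (Hw0 : w <> 0%C) by (intros ->; rewrite Cmod_0 in Hwm; lra).
  replace (/ w - / z - (w - z) * - (/ z * / z))%C
    with ((w - z) * ((w - z) * (/ w * (/ z * / z))))%C by (field; auto).
  rewrite !Cmod_mult, !Cmod_inv by trivial.
  rewrite Rmult_comm; apply Rmult_le_compat_r; [apply Cmod_ge_0|].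
  apply Rmult_le_reg_r with (Cmod w * Cmod z ^ 2); [apply Rmult_lt_0_compat; nra|].
  replace (Cmod (w - z) * (/ Cmod w * (/ Cmod z * / Cmod z)) * (Cmod w * Cmod z ^ 2))
    with (Cmod (w - z)) by (field; lra).
  pose proof (cond_pos eps).
  apply Rle_trans with (eps * (Cmod z / 2 * Cmod z ^ 2)); [lra|].
  apply Rmult_le_compat_l; [lra|]; apply Rmult_le_compat_r; nra.
Qed.

Lemma antipodal_free_involution : free_antiholomorphic_involution punctured_plane antipodal.
Proof.
  intros z Hz; split; [now apply antipodal_neq0|split; [now apply antipodal_involutive|split]].
  - now apply antipodal_free.
  - exists (- - (/ z * / z))%C.
    apply is_derive_ext with (fun w => opp (/ w)%C).
    + intros w; change (- / w = Cconj (antipodal w))%C.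
      rewrite antipodal_inv; unfold Cinv; apply injective_projections; simpl.
      * f_equal; f_equal; ring.
      * replace (fst w * (fst w * 1) + - snd w * (- snd w * 1))
          with (fst w * (fst w * 1) + snd w * (snd w * 1)) by ring.
        unfold Rdiv; ring.
    + apply (is_derive_opp (K := C_AbsRing) (V := C_NormedModule)), is_C_derive_inv, Hz.
Qed.

Lemma jacobian_antipodal (z : C) : z <> 0%C -> jacobian antipodal z = - (/ normsq z) ^ 2.
Proof.
  intros Hz; pose proof (normsq_pos z Hz) as Hp.
  assert (E : jacobian antipodal z
    = Derive (fun x => - x / (x ^ 2 + snd z ^ 2)) (fst z)
      * Derive (fun y => - y / (fst z ^ 2 + y ^ 2)) (snd z)
      - Derive (fun y => - fst z / (fst z ^ 2 + y ^ 2)) (snd z)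
        * Derive (fun x => - snd z / (x ^ 2 + snd z ^ 2)) (fst z)).
  { unfold jacobian, dx, dy.
    pose proof (locally_2d_1d_const_y _ _ _ (locally_2d_nonzero z Hz)) as Lx.
    pose proof (locally_2d_1d_const_x _ _ _ (locally_2d_nonzero z Hz)) as Ly.
    assert (Ex : forall p : C -> R, Derive (fun x => p (antipodal (x, snd z))) (fst z)
      = Derive (fun x => p (- x / (x ^ 2 + snd z ^ 2), - snd z / (x ^ 2 + snd z ^ 2))) (fst z)).
    { intros p; apply Derive_ext_loc; revert Lx; apply filter_imp; intros t Ht.
      now rewrite (antipodal_coord _ _ Ht). }
    assert (Ey : forall p : C -> R, Derive (fun y => p (antipodal (fst z, y))) (snd z)
      = Derive (fun y => p (- fst z / (fst z ^ 2 + y ^ 2), - y / (fst z ^ 2 + y ^ 2))) (snd z)).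
    { intros p; apply Derive_ext_loc; revert Ly; apply filter_imp; intros t Ht.
      now rewrite (antipodal_coord _ _ Ht). }
    now rewrite (Ex fst), (Ex snd), (Ey fst), (Ey snd). }
  rewrite E; clear E; unfold normsq in *.
  erewrite !is_derive_unique; [|auto_derive; [simpl in *; lra|reflexivity]..].
  field; simpl in *; lra.
Qed.

Lemma locally_constant_sign (s : R -> R) :
  (forall t, s t = 1 \/ s t = -1) -> (forall t, locally t (fun u => s u = s t)) ->
  forall a b, a < b -> s a = s b.
Proof.
  intros H1 H2 a b Hab; apply (eq_is_derive (V := R_NormedModule)); trivial.
  intros t _; apply is_derive_ext_loc with (fun _ => s t).
  - generalize (H2 t); apply filter_imp; now intros u ->.
  - apply (is_derive_const (V := R_NormedModule)).
Qed.

(* A local orientation would be constant along the half circle from 1 to -1 = antipodal 1. *)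
Lemma antipodal_not_orientable : ~ quot_orientable punctured_plane antipodal.
Proof.
  intros (o & Hsign & Hloc & Hjac).
  pose (c := fun t => (cos t, sin t) : C).
  assert (Hc : forall t, punctured_plane (c t)).
  { intros t E; injection E as E1 E2; pose proof (sin2_cos2 t) as H.
    rewrite E1, E2 in H; unfold Rsqr in H; lra. }
  assert (Hcc : forall t, continuous (T := R_UniformSpace) (U := C_UniformSpace) c t).
  { intros t; apply filterlim_locally; intros eps.
    assert (H1 : locally t (fun u => ball (cos t) eps (cos u)))
      by exact (continuous_cos t _ (locally_ball (cos t) eps)).
    assert (H2 : locally t (fun u => ball (sin t) eps (sin u)))
      by exact (continuous_sin t _ (locally_ball (sin t) eps)).
    generalize (filter_and _ _ H1 H2); apply filter_imp; intros u [B1 B2]; split; assumption. }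
  assert (E : o (c 0) = o (c PI)).
  { apply (locally_constant_sign (fun t => o (c t))); [intros t; now apply Hsign| |apply PI_RGT_0].
    intros t.
    assert (H : locally t (fun u => punctured_plane (c u) -> o (c u) = o (c t)))
      by exact (Hcc t _ (Hloc (c t) (Hc t))).
    revert H; apply filter_imp; auto. }
  pose proof (Hjac (c 0) (Hc 0)) as H; rewrite (jacobian_antipodal _ (Hc 0)) in H.
  replace (antipodal (c 0)) with (c PI) in H.
  (* The two orientation signs now agree, so their product is a square, while the Jacobian is
     negative. *)
  - rewrite <- E in H; pose proof (normsq_pos _ (Hc 0)) as Hp.
    pose proof (pow2_ge_0 (/ normsq (c 0))); pose proof (pow2_ge_0 (o (c 0))); nra.
  - unfold c; rewrite cos_PI, sin_PI, cos_0, sin_0, antipodal_coord.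
    + apply injective_projections; simpl; field.
    + intros E0; injection E0; lra.
Qed.

(** * Descent to the quotient and conclusion *)

Lemma finite_set_proj (A : C -> Prop) : finite_set A ->
  finite_set (fun q => exists (z : C) (Hz : punctured_plane z),
    A z /\ q = proj punctured_plane antipodal z Hz).
Proof.
  intros [l Hl].
  assert (H : exists l', forall z (Hz : punctured_plane z), In z l ->
    In (proj punctured_plane antipodal z Hz) l').
  { clear Hl; induction l as [|a l [l' IH]]; [now exists nil|].
    destruct (classic (punctured_plane a)) as [Ha|Ha].
    - exists (proj punctured_plane antipodal a Ha :: l'); intros z Hz [<-|Hi]; [left|right; auto].
      now rewrite (proof_irrelevance _ Ha Hz).
    - exists l'; intros z Hz [<-|Hi]; [contradiction|auto]. }
  destruct H as [l' Hl']; exists l'; intros q (z & Hz & HA & ->); auto.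
Qed.

Lemma invariant_map_lifts (X : C -> R3) :
  (forall z, punctured_plane z -> X (antipodal z) = X z) ->
  exists Xhat, is_lift punctured_plane antipodal Xhat X.
Proof.
  intros HX.
  (* A class only carries the existence of a representative; one is chosen by description, and
     invariance makes X independent of the choice. *)
  exists (fun q : quot punctured_plane antipodal => X (proj1_sig (constructive_indefinite_description _ (proj2_sig q)))).
  intros z Hz; simpl.
  destruct (constructive_indefinite_description _ _) as (w & Hw & E); simpl.
  assert (Ho : orbit antipodal w z) by (rewrite <- E; now left).
  destruct Ho as [-> | ->]; trivial; symmetry; now apply HX.
Qed.

Theorem mainTheorem1 (m : nat) (hm : (1 <= m)%nat) :
  (exists X : C -> R3,
     is_Re_integral punctured_plane (weierstrass_forms g_data (f_data m)) X) /\
  forall X : C -> R3,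
    is_Re_integral punctured_plane (weierstrass_forms g_data (f_data m)) X ->
    finitely_branched_minimal_immersion punctured_plane X /\
    (forall z : C, punctured_plane z -> X (antipodal z) = X z) /\
    exists Xhat : quot punctured_plane antipodal -> R3,
      one_sided punctured_plane antipodal Xhat X /\
      quot_complete punctured_plane antipodal Xhat /\
      quot_stable punctured_plane antipodal Xhat /\
      quot_finitely_branched_minimal punctured_plane antipodal Xhat.
Proof.
  split; [exists (weierstrass_X m); now apply weierstrass_X_integral|].
  intros X HI; pose proof (Re_integral_weierstrass_map m X hm HI) as HX.
  assert (Hfin : finite_set (branch_point punctured_plane X)).
  { apply finite_set_subset with (2 := finite_f_data_zeros m).
    intros z; now apply weierstrass_map_branch_point with (df_laurent m). }
  assert (Hmin : branched_minimal_immersion punctured_plane X).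
  { split; [now apply weierstrass_map_harmonic in HX|split; [now apply weierstrass_map_conformal in HX|]].
    intros z _; exists (mkposreal 1 Rlt_0_1).
    apply finite_set_subset with (2 := Hfin); now intros w [_ Hw]. }
  assert (Hinv : forall z : C, punctured_plane z -> X (antipodal z) = X z).
  { intros z Hz; destruct (Re_integral_eq m X hm HI) as ((k1 & H1) & (k2 & H2) & (k3 & H3)).
    pose proof (weierstrass_X_antipodal m z hm Hz) as E.
    pose proof (antipodal_neq0 z Hz) as Hz'.
    apply injective_projections; [apply injective_projections|].
    - change (pr1 (X (antipodal z)) = pr1 (X z)); rewrite (H1 _ Hz'), (H1 _ Hz); exact (f_equal (fun v => pr1 v + k1) E).
    - change (pr2 (X (antipodal z)) = pr2 (X z)); rewrite (H2 _ Hz'), (H2 _ Hz); exact (f_equal (fun v => pr2 v + k2) E).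
    - change (pr3 (X (antipodal z)) = pr3 (X z)); rewrite (H3 _ Hz'), (H3 _ Hz); exact (f_equal (fun v => pr3 v + k3) E). }
  split; [now split|split; [exact Hinv|]].
  destruct (invariant_map_lifts X Hinv) as [Xhat Hlift]; exists Xhat.
  split; [|split; [|split]].
  - split; [apply antipodal_free_involution|split; [apply antipodal_not_orientable|exact Hlift]].
  - exists X; split; trivial; intros q tau c; now apply weierstrass_map_complete with (m := m).
  - exists X; split; trivial; intros phi; now apply weierstrass_map_stable with (m := m).
  - exists X; split; [trivial|split; [trivial|now apply finite_set_proj]].
Qed.
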